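(* Let $\mu$ be a Borel probability measure on $\mathbb{R}$ with zero mean and unit variance, and write its $F$-transform in its Nevanlinna integral representation $$F_{\mu}(z)=z+\int_{\mathbb{R}}\frac{1}{t-z}\,d\nu(t),\qquad z\in\mathbb{C}^{+}.$$ For $n\ge 1$ let $\mu_n$ be the dilation $\mu_n(A)=\mu^{\triangleright n}(\sqrt{n}A)$ ($A$ Borel) of the $n$-th monotone convolution power of $\mu$, and let $\gamma$ be the arcsine measure $d\gamma(t)=\frac{1}{\pi\sqrt{2-t^2}}\,dt$ on $(-\sqrt2,\sqrt2)$. If the measure $\nu$ has first absolute moment $c=\int_{\mathbb{R}}|t|\,d\nu(t)\in(0,+\infty)$, then $$\sup_{x\in\mathbb{R}}\left|\mu_{n}\left((-\infty,x]\right)-\gamma\left((-\infty,x]\right)\right|\leq 71\sqrt[4]{c}\;n^{-1/8}$$ for all sufficiently large $n$.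
   Context: $\mathbb{C}^{+}=\{x+iy:y>0\}$. The $F$-transform of a Borel probability measure $\mu$ on $\mathbb{R}$ is the analytic map $F_\mu:\mathbb{C}^+\to\mathbb{C}^+$ defined by $\frac{1}{F_{\mu}(z)}=\int_{\mathbb{R}}\frac{1}{z-t}\,d\mu(t)$. The correspondence $\mu\mapsto F_\mu$ is a bijection between probability measures on $\mathbb{R}$ and analytic maps $F:\mathbb{C}^+\to\mathbb{C}^+$ with $F(iy)/(iy)\to1$ as $y\to\infty$. The $n$-th monotone convolution power $\mu^{\triangleright n}$ is the unique probability measure on $\mathbb{R}$ with $F_{\mu^{\triangleright n}}=F_\mu^{\circ n}$ ($n$-fold composition) on $\mathbb{C}^+$. When $\mu$ has zero mean and unit variance, $F_\mu$ has a unique Nevanlinna representation $F_\mu(z)=z+\int_{\mathbb{R}}\frac{1}{t-z}\,d\nu(t)$ with $\nu$ a finite Borel measure on $\mathbb{R}$ with $\nu(\mathbb{R})=1$. *)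

(* Defs.v *)
(* MathComp-Analysis; complex numbers are R[i] from mathcomp-real-closed. *)
From HB Require Import structures.
From mathcomp Require Import all_boot all_order all_algebra.
From mathcomp Require Import complex.
From mathcomp Require Import all_classical all_reals all_analysis.

Set Implicit Arguments.
Unset Strict Implicit.
Unset Printing Implicit Defensive.

Import Order.TTheory GRing.Theory Num.Theory.
Import numFieldNormedType.Exports.

Local Open Scope classical_set_scope.
Local Open Scope ring_scope.
Local Open Scope complex_scope.

Definition upper_half_plane (R : realType) : set R[i] :=
  [set z | 0 < complex.Im z].

(* Rintegral sends a divergent integral to a default real; below, the integrand
   is always bounded and the measure finite. *)
Definition Cintegral (R : realType)
    (m : {measure set (measurableTypeR R) -> \bar R}) (f : R -> R[i]) : R[i] :=
  Rintegral m setT (fun t => complex.Re (f t))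
  +i* Rintegral m setT (fun t => complex.Im (f t)).

Definition F_transform (R : realType)
    (mu : probability (measurableTypeR R) R) (z : R[i]) : R[i] :=
  (Cintegral mu (fun t => (z - t%:C)^-1))^-1.

Definition nevanlinna_measure (R : realType)
    (mu : probability (measurableTypeR R) R)
    (nu : {finite_measure set (measurableTypeR R) -> \bar R}) : Prop :=
  nu setT = 1%E /\
  forall z : R[i], upper_half_plane z ->
    F_transform mu z = z + Cintegral nu (fun t => (t%:C - z)^-1).

(* A probability measure is determined by its F-transform, so at most one mun
   satisfies this. *)
Definition is_monotone_power (R : realType)
    (mu : probability (measurableTypeR R) R) (n : nat)
    (mun : probability (measurableTypeR R) R) : Prop :=
  forall z : R[i], upper_half_plane z ->
    F_transform mun z = iter n (F_transform mu) z.

Definition dilation (R : realType) (s : R)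
    (m : {measure set (measurableTypeR R) -> \bar R}) (A : set R) : \bar R :=
  m [set s * t | t in A].

Definition arcsine (R : realType) (A : set R) : \bar R :=
  (\int[@lebesgue_measure R]_(t in (A `&` `]- Num.sqrt 2, Num.sqrt 2[)%R)
     (1 / (pi * Num.sqrt (2 - t ^+ 2)))%:E)%E.

(* Main.v *)
Require Import Defs.
From HB Require Import structures.
From mathcomp Require Import all_boot all_order all_algebra.
From mathcomp Require Import complex.
From mathcomp Require Import all_classical all_reals all_analysis.
From mathcomp Require Import ring lra zify measurable_realfun.

(** The Nevanlinna representation gives [F w ^ 2 = w ^ 2 - 2 + O(c / Im w)] for
    [F = F_mu].  Since [F] does not decrease the imaginary part, iterating and
    rescaling yields [F_n z ^ 2 = z ^ 2 - 2 + e] with [|e| <= y] on the line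
    [Im z = y], where [y = 4 sqrt (c / sqrt n)] and [F_n] is the F-transform of
    [mu_n].  Hence [1 / F_n] differs there from [1 / sqrt (z ^ 2 - 2)] by
    [O(y / rho ^ (3 / 2))], [rho] being the distance from [z] to the nearer of
    [- sqrt 2] and [sqrt 2]; integrating along the line, the Cauchy smoothing at
    scale [y] of the distribution function of [mu_n] is within [O(sqrt y)] of an
    explicit function, itself within [O(sqrt y)] of the arcsine distribution
    function.  As the latter is 1/2-Hölder, removing the smoothing costs another
    [O(sqrt y) = O(c ^ (1 / 4) n ^ (- 1 / 8))]. *)

Set Implicit Arguments.
Unset Strict Implicit.
Unset Printing Implicit Defensive.

Import Order.TTheory GRing.Theory Num.Theory.
Import numFieldNormedType.Exports.

Local Open Scope classical_set_scope.
Local Open Scope ring_scope.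

(** In the variable [w ^ 2] one application of [F] is a translation by [- 2] up to a small term, so
    under iteration the errors add up instead of compounding; for the arcsine law, whose F-transform
    is [sqrt (z ^ 2 - 2)], the translation is exact. After rescaling, the accumulated error is of
    order [c / (y sqrt n)], and asking that it be at most [y] dictates the size of [y]. The obstacle
    is at the edges [- sqrt 2] and [sqrt 2], where the square root is not Lipschitz:
    [rho ^ (- 3 / 2)] has an integral of order [y ^ (- 1 / 2)] on the line, which costs half of the
    exponent. No integral along the line is ever formed: a bound between derivatives becomes the
    monotonicity of explicit combinations. For the removal of the smoothing, the Cauchy kernel has
    no first moment, but its moment of order 1/2 is finite and matches the Hölder exponent; where
    only a crude bound is available, the unknown supremum itself enters with a factor 1/3 and is
    absorbed. *)

(** * Elementary estimates for arctangent, sine and arccosine *)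

Lemma atan_MVT (R : realType) (a b : R) :
  exists x, [/\ `|x - a| <= `|b - a|, `|x - b| <= `|b - a| &
             atan b - atan a = (1 + x ^+ 2)^-1 * (b - a)].
Proof.
wlog ab : a b / a <= b.
  move=> H; have [/H//|/ltW/H[x [xb xa E]]] := leP a b.
  exists x; rewrite (distrC b); split=> //.
  by rewrite -[LHS]opprB E -mulrN opprB.
have [x] := @MVT_segment R atan (fun x => (1 + x ^+ 2)^-1) a b ab
    (fun x _ => is_derive1_atan x) (continuous_subspaceT (@continuous_atan R)).
rewrite in_itv/= => /andP[ax xb] ->; exists x; split => //.
  by rewrite !ger0_norm ?subr_ge0// lerD2r.
by rewrite distrC !ger0_norm ?subr_ge0// lerD2l lerN2.
Qed.

(** The difference of the derivatives at [x] and [a] factors through [x - a], with a cofactor at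
    most 1 because [|a + x| <= (1 + x ^ 2) (1 + a ^ 2)]. A remainder uniform in [a] is what later
    allows differentiation under an integral. *)
Lemma atan_taylor1 (R : realType) (a b : R) :
  `|atan b - atan a - (b - a) / (1 + a ^+ 2)| <= (b - a) ^+ 2.
Proof.
have [x [xa _ ->]] := atan_MVT a b.
have -> : (1 + x ^+ 2)^-1 * (b - a) - (b - a) / (1 + a ^+ 2) =
   (b - a) * ((x - a) * - ((a + x) / ((1 + x ^+ 2) * (1 + a ^+ 2)))).
  by field; rewrite !gt_eqF//; nra.
rewrite !normrM -[leRHS]real_normK ?num_real// expr2.
apply: ler_pM => //; rewrite -[leRHS]mulr1; apply: ler_pM => //.
rewrite normrN normf_div [X in _ / X]gtr0_norm; last by nra.
rewrite ler_pdivrMr; last by nra.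
have h := sqr_ge0 (x * a); have := sqr_ge0 (a + 2^-1); have := sqr_ge0 (x + 2^-1).
have := sqr_ge0 (a - 2^-1); have := sqr_ge0 (x - 2^-1).
by rewrite mul1r ler_norml => *; apply/andP; split; nra.
Qed.

Lemma atan_le (R : realType) (x : R) : 0 <= x -> atan x <= x.
Proof.
move=> x0; have [y [_ _]] := atan_MVT 0 x; rewrite atan0 !subr0 => ->.
by rewrite ler_piMl// invf_le1; nra.
Qed.

Lemma tan_ge (R : realType) (x : R) : 0 <= x < pi / 2 -> x <= tan x.
Proof.
move=> /andP[x0 xp]; have p := pi_gt0 R.
have xI : x \in `](- (pi / 2)), (pi / 2)[ by rewrite in_itv/= xp andbT; lra.
rewrite -{1}(tanK xI) atan_le//; rewrite mulr_ge0 ?invr_ge0 ?cos_ge0_pihalf//; last lra.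
by rewrite sin_ge0_pi//; lra.
Qed.

(** [sin x = 2 tan (x / 2) cos (x / 2) ^ 2], where the tangent is at least [x / 2] and [cos x >= 0]
    makes the squared cosine at least 1/2. *)
Lemma sin_ge_half (R : realType) (x : R) : 0 <= x <= pi / 2 -> x / 2 <= sin x.
Proof.
move=> /andP[x0 xp]; have p := pi_gt0 R.
have x2 : 0 <= x / 2 < pi / 2 by lra.
have c0 : 0 < cos (x / 2) by apply: cos_gt0_pihalf; lra.
have Ex : x = (x / 2) *+ 2 by lra.
have c2 : 0 <= cos x by apply: cos_ge0_pihalf; lra.
have := tan_ge x2; rewrite /tan ler_pdivlMr// => H.
rewrite [in leRHS]Ex sin_mulr2n.
have : 1 <= cos (x / 2) ^+ 2 * 2 by move: c2; rewrite [X in cos X]Ex cos_mulr2n; nra.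
nra.
Qed.

(** With [u] and [v] the half sum and half difference of the two angles, the cosines differ by
    [2 sin u sin v]. As [v] is at most both [u] and [pi - u], each sine is at least [v / 2]. *)
Lemma acos_holder (R : realType) (a b : R) : -1 <= a <= 1 -> -1 <= b <= 1 ->
  (acos a - acos b) ^+ 2 <= 8 * `|a - b|.
Proof.
wlog ab : a b / acos b <= acos a.
  move=> H ha hb; have [h|/ltW h] := leP (acos b) (acos a); first exact: H.
  by rewrite -opprB sqrrN distrC; exact: H.
move=> ha hb.
have [ta0 tap ca] := And3 (acos_ge0 ha) (acos_lepi ha) (acosK ha).
have [tb0 tbp cb] := And3 (acos_ge0 hb) (acos_lepi hb) (acosK hb).
rewrite -[in leRHS]ca -[in leRHS]cb.
set s := acos a in ta0 tap ab *; set t := acos b in tb0 tbp ab *.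
pose u := (s + t) / 2; pose v := (s - t) / 2.
have -> : cos s = cos (u + v) by congr cos; rewrite /u /v; lra.
have -> : cos t = cos (u - v) by congr cos; rewrite /u /v; lra.
rewrite cosD cosB.
have -> : cos u * cos v - sin u * sin v - (cos u * cos v + sin u * sin v) =
   - (2 * (sin u * sin v)) by ring.
have v0 : 0 <= v by rewrite /v; lra.
have hv : v / 2 <= sin v by apply: sin_ge_half; rewrite v0 /v; lra.
have hu : v / 2 <= sin u.
  have [up|up] := leP u (pi / 2).
    by apply: le_trans (sin_ge_half _); rewrite /u /v in up *; lra.
  have -> : sin u = sin (pi - u) by rewrite sinB sinpi cospi ; lra.
  by apply: le_trans (sin_ge_half _); rewrite /u /v in up *; lra.
rewrite normrN ger0_norm; last by nra.
have -> : s - t = 2 * v by rewrite /v; lra.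
nra.
Qed.

Lemma sum_invsqrt_le (R : realType) (n : nat) :
  \sum_(1 <= j < n.+1) (Num.sqrt j%:R)^-1 <= 2 * Num.sqrt n%:R :> R.
Proof.
elim: n => [|n IH]; first by rewrite big_nil mulr_ge0.
rewrite big_nat_recr//= (le_trans (lerD IH (lexx _)))//.
set a := Num.sqrt n%:R; set b := Num.sqrt n.+1%:R.
have b0 : 0 < b by rewrite sqrtr_gt0.
have a0 : 0 <= a by rewrite sqrtr_ge0.
have ea : a ^+ 2 = n%:R by rewrite sqr_sqrtr.
have eb : b ^+ 2 = n%:R + 1 by rewrite sqr_sqrtr// natr1.
have -> : 2 * a + b^-1 = (2 * a * b + 1) / b by field; rewrite gt_eqF.
by rewrite ler_pdivrMr//; nra.
Qed.

(** * Elliptic coordinates, the smoothed arcsine law and a dominating function *)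

Lemma sqrt_sqrD_le (R : realType) (a b c d : R) :
  Num.sqrt (a ^+ 2 + b ^+ 2) <= Num.sqrt (c ^+ 2 + d ^+ 2) + `|a - c| + `|b - d|.
Proof.
set s := Num.sqrt (c ^+ 2 + d ^+ 2).
have s0 : 0 <= s by rewrite sqrtr_ge0.
have es : s ^+ 2 = c ^+ 2 + d ^+ 2 by rewrite sqr_sqrtr// addr_ge0// sqr_ge0.
have cs : `|c| <= s by rewrite -sqrtr_sqr ler_sqrt ?lerDl ?sqr_ge0// addr_ge0 ?sqr_ge0.
have ds : `|d| <= s by rewrite -sqrtr_sqr ler_sqrt ?lerDr ?sqr_ge0// addr_ge0 ?sqr_ge0.
have h : 0 <= s + `|a - c| + `|b - d| by rewrite !addr_ge0.
rewrite -(ger0_norm h) -sqrtr_sqr ler_sqrt ?sqr_ge0//.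
have ca : c * (a - c) <= s * `|a - c|.
  by rewrite (le_trans (ler_norm _))// normrM ler_wpM2r.
have db : d * (b - d) <= s * `|b - d|.
  by rewrite (le_trans (ler_norm _))// normrM ler_wpM2r.
have := real_normK (num_real (a - c)); have := real_normK (num_real (b - d)).
have := mulr_ge0 (normr_ge0 (a - c)) (normr_ge0 (b - d)).
nra.
Qed.

Definition focal_dist (R : realType) (a y x : R) : R :=
  Num.sqrt ((x - a) ^+ 2 + y ^+ 2).

Lemma focal_dist_ge0 (R : realType) (a y x : R) : 0 <= focal_dist a y x.
Proof. exact: sqrtr_ge0. Qed.

Lemma focal_dist_sqr (R : realType) (a y x : R) :
  focal_dist a y x ^+ 2 = (x - a) ^+ 2 + y ^+ 2.
Proof. by rewrite sqr_sqrtr// addr_ge0// sqr_ge0. Qed.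

Lemma focal_dist_ge (R : realType) (a y x : R) :
  `|x - a| <= focal_dist a y x.
Proof. by rewrite -sqrtr_sqr ler_sqrt ?lerDl ?sqr_ge0// addr_ge0 ?sqr_ge0. Qed.

Lemma focal_dist_gt0 (R : realType) (a y x : R) : 0 < y -> 0 < focal_dist a y x.
Proof. by move=> y0; rewrite sqrtr_gt0 ltr_wpDl ?sqr_ge0 ?exprn_gt0. Qed.

Lemma focal_dist_lip (R : realType) (a a' y x x' : R) :
  `|focal_dist a y x - focal_dist a' y x'| <= `|(x - a) - (x' - a')|.
Proof.
have := @sqrt_sqrD_le _ (x - a) y (x' - a') y.
have := @sqrt_sqrD_le _ (x' - a') y (x - a) y.
rewrite subrr normr0 !addr0 (distrC (x' - a')) -/(focal_dist a y x) -/(focal_dist a' y x').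
by move=> h1 h2; rewrite ler_norml; apply/andP; split; lra.
Qed.

Lemma focal_dist_lipy (R : realType) (a y x : R) : 0 <= y ->
  `|focal_dist a y x - focal_dist a 0 x| <= y.
Proof.
move=> y0; have := @sqrt_sqrD_le _ (x - a) y (x - a) 0.
have := @sqrt_sqrD_le _ (x - a) 0 (x - a) y.
rewrite !subrr normr0 !addr0 subr0 sub0r normrN ger0_norm//.
rewrite -/(focal_dist a y x) -/(focal_dist a 0 x).
by move=> h1 h2; rewrite ler_norml; apply/andP; split; lra.
Qed.

Lemma is_derive_focal_dist (R : realType) (a y x : R) : 0 < y ->
  is_derive x 1 (focal_dist a y) ((x - a) / focal_dist a y x).
Proof.
move=> y0.
have h : is_derive x 1 ((id - cst a) ^+ 2 + cst (y ^+ 2)) (2 * (x - a)).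
  apply: is_derive_eq; rewrite subr0 addr0 expr1 /=.
  by rewrite /= [LHS]mulr1.
have p : 0 < ((id - cst a) ^+ 2 + cst (y ^+ 2)) x.
  by rewrite ltr_wpDl ?sqr_ge0 ?exprn_gt0.
have := @is_derive1_comp _ Num.sqrt _ x _ _ (is_derive1_sqrt p) h.
have -> : Num.sqrt \o ((id - cst a) ^+ 2 + cst (y ^+ 2)) = focal_dist a y.
  by apply/funext.
move=> h2; apply: is_derive_eq h2 _; rewrite -/(focal_dist a y x).
have := @focal_dist_gt0 _ a _ x y0; set s := focal_dist a y x => s0.
by field; rewrite gt_eqF.
Qed.

(* With [z = x + i y] and foci [- sqrt 2, sqrt 2], writing
   [z = sqrt 2 * cosh (t + i theta)] gives [ellipse_cos y x = cos theta] and
   [ellipse_cosh y x = cosh t]. *)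
Definition ellipse_cos (R : realType) (y x : R) : R :=
  (focal_dist (- Num.sqrt 2) y x - focal_dist (Num.sqrt 2) y x) / (2 * Num.sqrt 2).
Definition ellipse_cosh (R : realType) (y x : R) : R :=
  (focal_dist (- Num.sqrt 2) y x + focal_dist (Num.sqrt 2) y x) / (2 * Num.sqrt 2).

Lemma sqrt2_bounds (R : realType) :
  [/\ Num.sqrt 2 ^+ 2 = 2 :> R, 14 / 10 <= Num.sqrt 2 :> R & Num.sqrt 2 <= 3 / 2 :> R].
Proof.
have h : Num.sqrt 2 ^+ 2 = 2 :> R by rewrite sqr_sqrtr.
by have := sqrtr_ge0 (2 : R); split=> //; nra.
Qed.

Lemma ellipse_cos_bounds (R : realType) (y x : R) : -1 <= ellipse_cos y x <= 1.
Proof.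
have [r2 r14 r15] := sqrt2_bounds R; set r := Num.sqrt 2 in r2 r14 r15 *.
have := @focal_dist_lip _ (- r) r y x x; rewrite /ellipse_cos -/r.
have -> : x - - r - (x - r) = 2 * r by ring.
rewrite (@ger0_norm _ (2 * r)); last lra.
by rewrite ler_norml ler_pdivlMr ?ler_pdivrMr; lra.
Qed.

Lemma ellipse_cos_lip (R : realType) (y x x' : R) :
  `|ellipse_cos y x - ellipse_cos y x'| <= `|x - x'|.
Proof.
have [r2 r14 r15] := sqrt2_bounds R; set r := Num.sqrt 2 in r2 r14 r15 *.
have := @focal_dist_lip _ (- r) (- r) y x x'; have := @focal_dist_lip _ r r y x x'.
have E b : x - b - (x' - b) = x - x' by ring.
rewrite !E /ellipse_cos -/r -mulrBl normrM normfV (@ger0_norm _ (2 * r)); last lra.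
move=> h1 h2; rewrite ler_pdivrMr; last lra.
have -> (a b c d : R) : a - b - (c - d) = (a - c) - (b - d) by ring.
by have := normr_ge0 (x - x'); move=> ?; apply: (le_trans (ler_normB _ _)); nra.
Qed.

Lemma ellipse_cos_lipy (R : realType) (y x : R) : 0 <= y ->
  `|ellipse_cos y x - ellipse_cos 0 x| <= y.
Proof.
move=> y0; have [r2 r14 r15] := sqrt2_bounds R; set r := Num.sqrt 2 in r2 r14 r15 *.
have := focal_dist_lipy (- r) x y0; have := focal_dist_lipy r x y0.
rewrite /ellipse_cos -/r -mulrBl normrM normfV (@ger0_norm _ (2 * r)); last lra.
have -> (a b c d : R) : a - b - (c - d) = (a - c) - (b - d) by ring.
move=> h1 h2; rewrite ler_pdivrMr; last lra.
by apply: (le_trans (ler_normB _ _)); nra.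
Qed.

(* [arcsine_cdf 0] is the distribution function of the arcsine law, and
   [arcsine_cdf y] its smoothing by the Cauchy kernel of scale [y]. *)
Definition arcsine_cdf (R : realType) (y x : R) : R := 1 - acos (ellipse_cos y x) / pi.

(** The constant 3/2 comes from [8 <= 3 ^ 2] and [pi >= 2]. *)
Lemma acos_div_pi_holder (R : realType) (a b d : R) : -1 <= a <= 1 -> -1 <= b <= 1 ->
  `|a - b| <= d ->
  `|(1 - acos a / pi) - (1 - acos b / pi)| <= 3 / 2 * Num.sqrt d.
Proof.
move=> ha hb hd; have d0 : 0 <= d by exact: le_trans hd.
have := acos_holder ha hb; have p2 := pi_ge2 R.
have -> : (1 - acos a / pi) - (1 - acos b / pi) = (acos b - acos a) / pi by ring.
have ed : Num.sqrt d ^+ 2 = d by rewrite sqr_sqrtr.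
have := sqrtr_ge0 d; set s := Num.sqrt d in ed * => s0.
rewrite normrM normfV (@ger0_norm _ pi) ?pi_ge0// ler_pdivrMr ?pi_gt0// => h.
have h1 : `|acos b - acos a| <= 3 * s.
  by rewrite -(@ler_pXn2r _ 2%N) ?nnegrE ?mulr_ge0// real_normK ?num_real//; nra.
nra.
Qed.

Lemma arcsine_cdf_holder (R : realType) (y x x' : R) :
  `|arcsine_cdf y x - arcsine_cdf y x'| <= 3 / 2 * Num.sqrt `|x - x'|.
Proof. by apply: acos_div_pi_holder; rewrite ?ellipse_cos_bounds// ellipse_cos_lip. Qed.

Lemma arcsine_cdf_holdery (R : realType) (y x : R) : 0 <= y ->
  `|arcsine_cdf y x - arcsine_cdf 0 x| <= 3 / 2 * Num.sqrt y.
Proof. by move=> y0; apply: acos_div_pi_holder; rewrite ?ellipse_cos_bounds// ellipse_cos_lipy. Qed.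

(** Subtracting the two equations for the squared focal distances yields [x]; either of them then
    yields [y ^ 2], which is [2 sinh ^ 2 sin ^ 2] in the hyperbolic coordinates. *)
Lemma ellipse_coords (R : realType) (y x : R) (r := Num.sqrt 2 : R)
    (C := ellipse_cosh y x) (k := ellipse_cos y x) :
  [/\ focal_dist (- r) y x = r * (C + k), focal_dist r y x = r * (C - k),
      x = r * C * k & y ^+ 2 = 2 * (C ^+ 2 - 1) * (1 - k ^+ 2)].
Proof.
have [r2 r14 r15] := sqrt2_bounds R; rewrite -/r in r2 r14 r15.
have eA : focal_dist (- r) y x = r * (C + k).
  by rewrite /C /k /ellipse_cosh /ellipse_cos -/r; field; lra.
have eB : focal_dist r y x = r * (C - k).
  by rewrite /C /k /ellipse_cosh /ellipse_cos -/r; field; lra.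
have := focal_dist_sqr (- r) y x; have := focal_dist_sqr r y x; rewrite eA eB => h1 h2.
have rn : r != 0 by lra.
have ex : x = r * C * k.
  by apply: (mulfI rn); apply: (@mulfI _ 4) => //; nra.
split=> //; have : x ^+ 2 = 2 * (C * k) ^+ 2 by rewrite [in LHS]ex -r2; ring.
nra.
Qed.

Lemma is_derive_ellipse_cos (R : realType) (y x : R) : 0 < y ->
  is_derive x 1 (ellipse_cos y)
    (Num.sqrt 2 * ellipse_cosh y x * (1 - ellipse_cos y x ^+ 2) /
     (focal_dist (- Num.sqrt 2) y x * focal_dist (Num.sqrt 2) y x)).
Proof.
move=> y0; have [r2 r14 r15] := sqrt2_bounds R.
have [eA eB ex ey] := ellipse_coords y x.
have A0 := focal_dist_gt0 (- Num.sqrt 2) x y0; have B0 := focal_dist_gt0 (Num.sqrt 2) x y0.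
have hA := is_derive_focal_dist (- Num.sqrt 2) x y0.
have hB := is_derive_focal_dist (Num.sqrt 2) x y0.
have := @is_deriveM _ _ (focal_dist (- Num.sqrt 2) y - focal_dist (Num.sqrt 2) y)
  (cst (2 * Num.sqrt 2)^-1) x 1 _ _ (is_deriveB hA hB) (is_derive_cst _ _ _).
have -> : (focal_dist (- Num.sqrt 2) y - focal_dist (Num.sqrt 2) y) *
   cst (2 * Num.sqrt 2)^-1 = ellipse_cos y by apply/funext.
move=> h; apply: is_derive_eq h _.
move: eA eB ex ey A0 B0; set r := Num.sqrt 2 in r2 r14 r15 *.
set C := ellipse_cosh y x; set k := ellipse_cos y x.
set A := focal_dist _ _ _; set B := focal_dist _ _ _ => eA eB ex ey A0 B0.
rewrite scaler0 add0r /=.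
transitivity (((x + r) * B - (x - r) * A) / (2 * r) / (A * B)).
  by rewrite /GRing.scale /=; field; rewrite !gt_eqF//; lra.
congr (_ / _); rewrite ex eA eB -[in RHS](@mulfK _ (2 * r) _ (r * C * _)); last lra.
by congr (_ / _); ring: r2.
Qed.

(* [p + i q] is the square root of [z ^ 2 - 2] in the upper half-plane, and the
   derivative is [- Im (p + i q)^-1 / pi]. *)
Lemma is_derive_arcsine_cdf (R : realType) (y x : R) : 0 < y ->
  exists p q : R, [/\ 0 < q, p ^+ 2 - q ^+ 2 = x ^+ 2 - y ^+ 2 - 2, p * q = x * y,
    p ^+ 2 + q ^+ 2 = focal_dist (- Num.sqrt 2) y x * focal_dist (Num.sqrt 2) y x &
    is_derive x 1 (arcsine_cdf y) (q / (p ^+ 2 + q ^+ 2) / pi)].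
Proof.
move=> y0; have [r2 r14 r15] := sqrt2_bounds R.
have [eA eB ex ey] := ellipse_coords y x.
have A0 := focal_dist_gt0 (- Num.sqrt 2) x y0; have B0 := focal_dist_gt0 (Num.sqrt 2) x y0.
have hk := is_derive_ellipse_cos x y0.
have kb := ellipse_cos_bounds y x.
move: hk eA eB ex ey A0 B0 kb; set r := Num.sqrt 2 in r2 r14 r15 *.
set C := ellipse_cosh y x; set k := ellipse_cos y x.
set A := focal_dist _ _ _; set B := focal_dist _ _ _ => hk eA eB ex ey A0 B0 /andP[k1 k2].
have C0 : 0 < C by nra.
have k3 : 0 < 1 - k ^+ 2.
  rewrite lt_neqAle; apply/andP; split; last nra.
  by apply/eqP => E; move: ey; rewrite -E mulr0 => ey; have := exprn_gt0 2 y0; lra.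
pose t := Num.sqrt (1 - k ^+ 2).
have t0 : 0 < t by rewrite sqrtr_gt0.
have et : t ^+ 2 = 1 - k ^+ 2 by rewrite sqr_sqrtr// ltW.
(* The root of [z ^ 2 - 2] is [sqrt 2 sinh (tau + i theta)]; here [C = cosh tau], [k = cos theta],
   [t = sin theta], and [sqrt 2 sinh tau] is written [y / t]. *)
exists (k * y / t), (r * C * t).
have tn : t != 0 by rewrite gt_eqF.
have ep2 : (k * y / t) ^+ 2 = 2 * k ^+ 2 * (C ^+ 2 - 1).
  rewrite expr_div_n exprMn ey -et; field; done.
have eq2 : (r * C * t) ^+ 2 = 2 * C ^+ 2 * (1 - k ^+ 2).
  by rewrite -et -r2; ring.
have ex2 : x ^+ 2 = 2 * (C * k) ^+ 2 by rewrite ex -r2; ring.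
have eS : (k * y / t) ^+ 2 + (r * C * t) ^+ 2 = A * B.
  rewrite ep2 eq2 eA eB; transitivity (r ^+ 2 * ((C + k) * (C - k))); last by ring.
  by rewrite r2; ring.
split=> //.
- have rp : 0 < r by lra.
  exact: (mulr_gt0 (mulr_gt0 rp C0) t0).
- by rewrite ep2 eq2 ex2 ey; ring.
- by rewrite [in RHS]ex; field.
rewrite eS.
have kI : -1 < k < 1 by apply/andP; split; nra.
have h1 := @is_derive1_comp _ acos (ellipse_cos y) x _ _ (is_derive1_acos kI) hk.
have := @is_deriveB _ _ _ _ _ _ _ _ _ (is_derive_cst (1 : R) x 1)
  (@is_deriveM _ _ _ (cst (pi : R)^-1) x 1 _ _ h1 (is_derive_cst _ _ _)).
have -> : cst 1 - (acos \o ellipse_cos y) * cst pi^-1 = arcsine_cdf y by apply/funext.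
move=> h; apply: is_derive_eq h _.
transitivity (- (pi^-1 * (- t^-1 * (r * C * (1 - k ^+ 2) / (A * B))))).
  have E0 (a b : R) : a * 0 + b = b by rewrite mulr0 add0r.
  by rewrite -[RHS]sub0r; exact: (congr1 (fun w => 0 - w) (E0 _ _)).
rewrite -et.
have [An Bn pn] : [/\ A != 0, B != 0 & pi != 0 :> R] by rewrite !gt_eqF ?pi_gt0.
by move: (pi : R) pn => w wn; field; rewrite tn An Bn ?wn.
Qed.

(* A bounded function whose derivative dominates [rho ^ (- 3 / 2)], where [rho] is
   the distance to [a]: it controls the integral of that power along the line. *)
Lemma is_derive_atan_sqrt_focal (R : realType) (a y x : R) : 0 < y ->
  exists2 d, is_derive x 1 (fun x => atan (Num.sqrt ((focal_dist a y x + (x - a)) / y))) d &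
    Num.sqrt y / (4 * (focal_dist a y x * Num.sqrt (focal_dist a y x))) <= d.
Proof.
move=> y0; have h := is_derive_focal_dist a x y0.
have s0 := focal_dist_gt0 a x y0; have es := focal_dist_sqr a y x.
have h1 := @is_deriveM _ _ _ (cst y^-1) x 1 _ _
  (is_deriveD h (is_deriveB (is_derive_id x 1) (is_derive_cst a x 1)))
  (is_derive_cst _ _ _).
set f := (X in is_derive _ _ X _) in h1.
have fE z : f z = (focal_dist a y z + (z - a)) / y by [].
move: h1 s0 es; set s := focal_dist a y x => h1 s0 es.
have f0 : 0 < f x.
  by rewrite fE -/s divr_gt0//; have := exprn_gt0 2 y0; have := sqr_ge0 (s - (x - a)); nra.
have h2 := @is_derive1_comp _ Num.sqrt f x _ _ (is_derive1_sqrt f0) h1.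
have := @is_derive1_comp _ atan _ x _ _ (is_derive1_atan _) h2.
set g := (X in is_derive _ _ X _).
have -> : g = (fun x => atan (Num.sqrt ((focal_dist a y x + (x - a)) / y))) by apply/funext.
set d := (X in is_derive _ _ _ X) => h3; exists d => //.
pose k := Num.sqrt (f x).
have k0 : 0 < k by rewrite sqrtr_gt0.
have ek : k ^+ 2 = (s + (x - a)) / y by rewrite sqr_sqrtr ?(ltW f0)// fE.
have -> : d = k / (2 * (1 + k ^+ 2) * s).
  rewrite /d scaler0 add0r /= /GRing.scale /= -/k subr0.
  have -> : (x - a) / s + 1 = k ^+ 2 * y / s by rewrite ek; field; rewrite !gt_eqF.
  by field; rewrite !gt_eqF//; nra.
pose Y := Num.sqrt y; pose G := Num.sqrt s.
have Y0 : 0 < Y by rewrite sqrtr_gt0.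
have G0 : 0 < G by rewrite sqrtr_gt0.
have eY : Y ^+ 2 = y by rewrite sqr_sqrtr// ltW.
have eG : G ^+ 2 = s by rewrite sqr_sqrtr// ltW.
rewrite -/Y -/G.
(* [k ^ 2] is the cotangent of half the argument of [z - a], whose sine is [y / s]. With
   [(1 + k ^ 2) ^ 2 <= 2 (1 + k ^ 4)] this gives the square of the next inequality. *)
have key : y * (k ^+ 4 + 1) = 2 * s * k ^+ 2.
  rewrite -[4%N]/(2 * 2)%N exprM ek; field: es; last by rewrite gt_eqF.
have : Y * (1 + k ^+ 2) <= 2 * G * k.
  have k1 : 0 <= 1 + k ^+ 2 by nra.
  rewrite -(@ler_pXn2r _ 2%N) ?nnegrE ?mulr_ge0 ?(ltW Y0) ?(ltW G0) ?(ltW k0)//.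
  by rewrite !exprMn eY eG; have := mulr_ge0 (ltW y0) (sqr_ge0 (k ^+ 2 - 1)); nra.
move=> H; rewrite ler_pdivrMr; last by rewrite !mulr_gt0.
rewrite mulrAC ler_pdivlMr; last by rewrite !mulr_gt0//; nra.
nra.
Qed.

(** * Perturbation of the square root of [z ^ 2 - 2] *)

(** Put [w = u + i v] and [w0 = p + i q]. Since [(w - w0) (w + w0) = e1 + i e2] has modulus at most
    [y] and [|w + w0| >= |w0|], the inverses differ by at most [y / (|w| |w0| ^ 2)]. In the
    application [s] is the distance to the nearer focus. *)
Lemma inv_sqrt_perturbation (R : realType) (x y p q u v e1 e2 s : R) :
  0 < y -> 0 < q -> 0 < v -> y <= s ->
  p ^+ 2 - q ^+ 2 = x ^+ 2 - y ^+ 2 - 2 -> p * q = x * y ->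
  Num.sqrt 2 * s <= p ^+ 2 + q ^+ 2 ->
  u ^+ 2 - v ^+ 2 = x ^+ 2 - y ^+ 2 - 2 + e1 -> 2 * (u * v) = 2 * (x * y) + e2 ->
  e1 ^+ 2 + e2 ^+ 2 <= y ^+ 2 ->
  `|v / (u ^+ 2 + v ^+ 2) - q / (p ^+ 2 + q ^+ 2)| <= 5 / 4 * y / (s * Num.sqrt s).
Proof.
move=> y0 q0 v0 ys Epq Epq' hs Euv Euv' he.
have [r2 r14 r15] := sqrt2_bounds R; set r := Num.sqrt 2 in r2 r14 r15 hs *.
have e1y : `|e1| <= y.
  by rewrite -(@ler_pXn2r _ 2%N) ?nnegrE ?(ltW y0)// real_normK ?num_real//; nra.
have e2y : `|e2| <= y.
  by rewrite -(@ler_pXn2r _ 2%N) ?nnegrE ?(ltW y0)// real_normK ?num_real//; nra.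
have /andP[e1l e1u] : - y <= e1 <= y by rewrite -ler_norml.
have /andP[e2l e2u] : - y <= e2 <= y by rewrite -ler_norml.
(* The two roots lie on the same side, which excludes cancellation in [w + w0]. If [x ^ 2 >= 1],
   both [u v] and [p q] have the sign of [x]; otherwise both roots are within 45 degrees of the
   imaginary axis. *)
have dot : 0 <= u * p + v * q.
  have [x1|x1] := leP 1 (x ^+ 2).
    suff : 0 <= (u * v) * (p * q).
      have -> : u * v * (p * q) = (u * p) * (v * q) by ring.
      by rewrite pmulr_lge0 ?mulr_gt0// => ?; rewrite addr_ge0// ltW// mulr_gt0.
    rewrite Epq'; have -> : u * v = x * y + e2 / 2 by lra.
    have [x2|x2] := leP 0 x.
      have : 1 <= x by nra.
      nra.
    have : x <= -1 by nra.
    nra.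
  have up : `|u| <= v.
    rewrite -(@ler_pXn2r _ 2%N) ?nnegrE ?(ltW v0)// real_normK ?num_real//.
    by have := sqr_ge0 (y - 2^-1); nra.
  have pq : `|p| <= q.
    by rewrite -(@ler_pXn2r _ 2%N) ?nnegrE ?(ltW q0)// real_normK ?num_real//; nra.
  have : `|u * p| <= v * q by rewrite normrM ler_pM.
  by rewrite ler_norml => /andP[h _]; lra.
pose N := u ^+ 2 + v ^+ 2; pose W := p ^+ 2 + q ^+ 2; rewrite -/N -/W.
have N0 : 0 < N by rewrite /N; nra.
have W0 : 0 < W by rewrite /W; nra.
have s0 : 0 < s by lra.
(* [N = |w ^ 2|] and [W = |w0 ^ 2|], so this is the triangle inequality, proved through
   Cauchy-Schwarz on squares. *)
have NW : W - y <= N.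
  pose E := Num.sqrt (e1 ^+ 2 + e2 ^+ 2).
  have E0 : 0 <= E by rewrite sqrtr_ge0.
  have eE : E ^+ 2 = e1 ^+ 2 + e2 ^+ 2 by rewrite sqr_sqrtr// addr_ge0// sqr_ge0.
  have Ey : E <= y by rewrite -(@ler_pXn2r _ 2%N) ?nnegrE ?(ltW y0)// eE.
  pose a := x ^+ 2 - y ^+ 2 - 2; pose b := 2 * (x * y).
  have EW : W ^+ 2 = a ^+ 2 + b ^+ 2 by rewrite /a /b -Epq -Epq' /W; ring.
  have EN : N ^+ 2 = (a + e1) ^+ 2 + (b + e2) ^+ 2 by rewrite /a /b -Euv -Euv' /N; ring.
  have cs : - (W * E) <= a * e1 + b * e2.
    have : `|a * e1 + b * e2| <= W * E.
      have WE0 : 0 <= W * E by rewrite mulr_ge0// ltW.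
      rewrite -(@ler_pXn2r _ 2%N) ?nnegrE// real_normK ?num_real// exprMn EW eE.
      by rewrite -subr_ge0 (_ : _ - _ = (a * e2 - b * e1) ^+ 2) ?sqr_ge0//; ring.
    by rewrite ler_norml => /andP[].
  have h : W - E <= N.
    have [WE|WE] := leP (W - E) 0; first by lra.
    by rewrite -(@ler_pXn2r _ 2%N) ?nnegrE ?(ltW WE) ?(ltW N0)//; nra.
  by lra.
have D2 : (v / N - q / W) ^+ 2 <= y ^+ 2 / (N * W ^+ 2).
  apply: (@le_trans _ _ (((u - p) ^+ 2 + (v - q) ^+ 2) / (N * W))).
    rewrite -subr_ge0.
    have -> : ((u - p) ^+ 2 + (v - q) ^+ 2) / (N * W) - (v / N - q / W) ^+ 2 =
      (u / N - p / W) ^+ 2.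
      by rewrite /N /W; field; rewrite -/N -/W !gt_eqF.
    exact: sqr_ge0.
  rewrite ler_pdivrMr ?mulr_gt0//.
  have -> : y ^+ 2 / (N * W ^+ 2) * (N * W) = y ^+ 2 / W by field; rewrite !gt_eqF.
  rewrite ler_pdivlMr//.
  apply: (@le_trans _ _ (((u - p) ^+ 2 + (v - q) ^+ 2) * ((u + p) ^+ 2 + (v + q) ^+ 2))).
    by apply: ler_wpM2l; [nra|rewrite /W; nra].
  have -> : ((u - p) ^+ 2 + (v - q) ^+ 2) * ((u + p) ^+ 2 + (v + q) ^+ 2) =
    (u ^+ 2 - v ^+ 2 - (p ^+ 2 - q ^+ 2)) ^+ 2 + (2 * (u * v) - 2 * (p * q)) ^+ 2 by ring.
  rewrite Euv Euv' Epq Epq'; apply: le_trans he.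
  by rewrite le_eqVlt; apply/orP; left; apply/eqP; ring.
have G0 : 0 < Num.sqrt s by rewrite sqrtr_gt0.
have eG : Num.sqrt s ^+ 2 = s by rewrite sqr_sqrtr// ltW.
have d0 : 0 <= 5 / 4 * y / (s * Num.sqrt s) by rewrite divr_ge0// ?mulr_ge0 ?ltW.
rewrite -(@ler_pXn2r _ 2%N) ?nnegrE ?normr_ge0// real_normK ?num_real//.
apply: (le_trans D2).
rewrite expr_div_n !exprMn eG.
rewrite ler_pdivrMr ?mulr_gt0 ?exprn_gt0//.
rewrite [leRHS]mulrAC ler_pdivlMr ?mulr_gt0 ?exprn_gt0//.
(* [sqrt 2 - 1 >= 4 / 10] and [y <= s]. The constant 5/4 is admissible because
   [(4 / 10) 2 (5 / 4) ^ 2 >= 1]. *)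
have hN : 4 / 10 * s <= N by apply: le_trans NW; rewrite -/W in hs; nra.
have hW : 2 * s ^+ 2 <= W ^+ 2 by rewrite -r2 -exprMn lerXn2r// nnegrE; nra.
have : 4 / 10 * s * (2 * s ^+ 2) <= N * W ^+ 2 by apply: ler_pM => //; nra.
move=> h; have := ler_wpM2l (sqr_ge0 y) h.
have : 0 <= y ^+ 2 * (s ^+ 2 * s) by rewrite !mulr_ge0 ?sqr_ge0// ltW.
by lra.
Qed.

(** * Poisson integrals and the Stieltjes transform *)

Lemma bounded_continuous_integrable (R : realType)
    (m : {finite_measure set (measurableTypeR R) -> \bar R}) (f : R -> R) (K : R) :
  continuous f -> (forall t, `|f t| <= K) -> m.-integrable setT (EFin \o f).
Proof.
move=> cf bf; apply: measurable_bounded_integrable => //.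
- by rewrite -ge0_fin_numE// fin_num_measure.
- exact: continuous_measurable_fun.
- exists K; split; first exact: num_real.
  by move=> x Kx t _; apply: (le_trans (bf t)); exact: ltW.
Qed.

Lemma normr_Rintegral_le (R : realType)
    (m : {finite_measure set (measurableTypeR R) -> \bar R}) (f g : R -> R) :
  m.-integrable setT (EFin \o f) -> m.-integrable setT (EFin \o g) ->
  (forall t, `|f t| <= g t) ->
  `|Rintegral m setT f| <= Rintegral m setT g.
Proof.
move=> If Ig fg; apply: (le_trans (le_normr_Rintegral measurableT If)).
apply: le_Rintegral => //; exact: (integrable_abse If).
Qed.

Lemma denom_gt0 (R : realType) (a b t : R) : 0 < b -> 0 < (t - a) ^+ 2 + b ^+ 2.
Proof. by move=> b0; rewrite ltr_wpDl ?sqr_ge0 ?exprn_gt0. Qed.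

Lemma continuous_ratio (R : realType) (a b : R) (f : R -> R) : 0 < b -> continuous f ->
  continuous (fun t => f t / ((t - a) ^+ 2 + b ^+ 2)).
Proof.
move=> b0 cf t; apply: cvgM; first exact: cf.
apply: cvgV; first by rewrite gt_eqF// denom_gt0.
apply: cvgD; last exact: cvg_cst.
have ct : (t - a) @[t --> t] --> t - a by apply: cvgB; [exact: cvg_id|exact: cvg_cst].
by apply: (cvgM ct ct).
Qed.

Lemma continuous_subr (R : realType) (a : R) : continuous (fun t : R => t - a).
Proof. by move=> t; apply: cvgB; [exact: cvg_id|exact: cvg_cst]. Qed.

Lemma poisson_bound (R : realType) (a b t : R) : 0 < b ->
  `|b / ((t - a) ^+ 2 + b ^+ 2)| <= b^-1.
Proof.
move=> b0; have d0 := denom_gt0 a t b0.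
rewrite ger0_norm ?divr_ge0 ?(ltW b0) ?(ltW d0)// ler_pdivrMr// ler_pdivlMl//.
by have := sqr_ge0 (t - a); nra.
Qed.

Lemma conj_poisson_bound (R : realType) (a b t : R) : 0 < b ->
  `|(t - a) / ((t - a) ^+ 2 + b ^+ 2)| <= (2 * b)^-1.
Proof.
move=> b0; have d0 := denom_gt0 a t b0.
rewrite normrM normfV (gtr0_norm d0) ler_pdivrMr// ler_pdivlMl ?mulr_gt0//.
rewrite -real_normK ?num_real//.
by have := sqr_ge0 (`|t - a| - b); nra.
Qed.

Section stieltjes.
Variables (R : realType) (m : {finite_measure set (measurableTypeR R) -> \bar R}).
Variables (a b : R).
Hypothesis b0 : 0 < b.
Hypothesis m1 : m setT = 1%E.

(** For [w = a + i b], [Q] and [P] are the real and imaginary parts of [1 / (t - w)]. *)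
Let P t := b / ((t - a) ^+ 2 + b ^+ 2).
Let Q t := (t - a) / ((t - a) ^+ 2 + b ^+ 2).

Lemma integrable_poisson : m.-integrable setT (EFin \o P).
Proof.
apply: (@bounded_continuous_integrable _ _ _ b^-1); last by move=> t; exact: poisson_bound.
by apply: continuous_ratio => // t; exact: cvg_cst.
Qed.

Lemma integrable_conj_poisson : m.-integrable setT (EFin \o Q).
Proof.
apply: (@bounded_continuous_integrable _ _ _ (2 * b)^-1); last first.
  by move=> t; exact: conj_poisson_bound.
by apply: continuous_ratio => //; exact: continuous_subr.
Qed.

Lemma integrable_cst1 (k : R) : m.-integrable setT (EFin \o cst k).
Proof. exact: finite_measure_integrable_cst. Qed.

Lemma Rintegral_cst1 (k : R) : Rintegral m setT (cst k) = k.
Proof. rewrite Rintegral_cst//; transitivity (k * fine (m setT)) => //.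
by rewrite m1 mulr1. Qed.

Lemma Cintegral_stieltjes : Cintegral m (fun t => (t%:C - Complex a b)^-1)%C =
  Complex (Rintegral m setT Q) (Rintegral m setT P).
Proof.
rewrite /Cintegral; congr Complex; congr fine; apply: eq_integral => t _; congr EFin.
  by rewrite /= /Q sub0r sqrrN.
by rewrite /= /P sub0r sqrrN mulNr opprK.
Qed.

Lemma poisson_ge0 : 0 <= Rintegral m setT P.
Proof.
by apply: Rintegral_ge0 => t _; rewrite divr_ge0 ?(ltW b0) ?(ltW (denom_gt0 _ _ b0)).
Qed.

Lemma poisson_le : Rintegral m setT P <= b^-1.
Proof.
rewrite -[leRHS]Rintegral_cst1 (le_trans (ler_norm _))//.
apply: normr_Rintegral_le; [exact: integrable_poisson|exact: integrable_cst1|].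
by move=> t; exact: poisson_bound.
Qed.

Lemma conj_poisson_le : `|Rintegral m setT Q| <= (2 * b)^-1.
Proof.
rewrite -[leRHS]Rintegral_cst1.
apply: normr_Rintegral_le; [exact: integrable_conj_poisson|exact: integrable_cst1|].
by move=> t; exact: conj_poisson_bound.
Qed.

Variable c : R.
Hypothesis moment : (\int[m]_t (`|t|)%:E)%E = c%:E.

Lemma Rintegral_le_moment (h : R -> R) : m.-integrable setT (EFin \o h) ->
  (forall t, `|h t| <= b^-1 * `|t|) -> `|Rintegral m setT h| <= c / b.
Proof.
move=> Ih hb.
have Ia : m.-integrable setT (EFin \o (fun t : R => `|t|)).
  apply/integrableP; split.
    by apply/measurable_EFinP; exact: measurableT_comp.
  apply: le_lt_trans (ltry c); rewrite -moment le_eqVlt; apply/orP; left; apply/eqP.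
  by apply: eq_integral => t _ /=; rewrite normr_id.
have -> : c / b = Rintegral m setT (fun t : R => b^-1 * `|t|).
  by rewrite RintegralZl// /Rintegral moment mulrC.
apply: normr_Rintegral_le => //.
by have := integrableZl measurableT b^-1 Ia; apply: eq_integrable.
Qed.

(* [w * G(w) + 1] is the integral of [t / (t - w)]. *)
Lemma stieltjes_moment_Re :
  `|a * Rintegral m setT Q - b * Rintegral m setT P + 1| <= c / b.
Proof.
have IaQ : m.-integrable setT (EFin \o (fun t => a * Q t)).
  by have := integrableZl measurableT a integrable_conj_poisson; apply: eq_integrable.
have IbP : m.-integrable setT (EFin \o (fun t => b * P t)).
  by have := integrableZl measurableT b integrable_poisson; apply: eq_integrable.
have IQP : m.-integrable setT (EFin \o (fun t => a * Q t - b * P t)).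
  by have := integrableB measurableT IaQ IbP; apply: eq_integrable.
have I1 := integrable_cst1 1.
have I : m.-integrable setT (EFin \o (fun t => a * Q t - b * P t + cst 1 t)).
  by have := integrableD measurableT IQP I1; apply: eq_integrable.
rewrite -[X in _ + X]Rintegral_cst1 -!RintegralZl//;
  [|exact: integrable_poisson|exact: integrable_conj_poisson].
rewrite -RintegralB// -RintegralD//; apply: Rintegral_le_moment => // t.
have d0 := denom_gt0 a t b0.
have -> : a * Q t - b * P t + cst 1 t = t * Q t.
  by rewrite /Q /P /=; field; rewrite gt_eqF.
rewrite normrM mulrC; apply: ler_wpM2r => //.
apply: (le_trans (conj_poisson_bound _ _ b0)).
by rewrite lef_pV2 ?posrE ?mulr_gt0// ler_peMl ?(ltW b0)// ler1n.
Qed.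

Lemma stieltjes_moment_Im :
  `|a * Rintegral m setT P + b * Rintegral m setT Q| <= c / b.
Proof.
have IaP : m.-integrable setT (EFin \o (fun t => a * P t)).
  by have := integrableZl measurableT a integrable_poisson; apply: eq_integrable.
have IbQ : m.-integrable setT (EFin \o (fun t => b * Q t)).
  by have := integrableZl measurableT b integrable_conj_poisson; apply: eq_integrable.
have I : m.-integrable setT (EFin \o (fun t => a * P t + b * Q t)).
  by have := integrableD measurableT IaP IbQ; apply: eq_integrable.
rewrite -!RintegralZl//; [|exact: integrable_conj_poisson|exact: integrable_poisson].
rewrite -RintegralD//; apply: Rintegral_le_moment => // t.
have d0 := denom_gt0 a t b0.
have -> : a * P t + b * Q t = t * P t.
  by rewrite /Q /P /=; field; rewrite gt_eqF.
by rewrite normrM mulrC; apply: ler_wpM2r => //; exact: poisson_bound.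
Qed.

End stieltjes.

(** * Iterates of the F-transform *)

(** With [F w = w + g], [F w ^ 2 = w ^ 2 - 2 + 2 (w g + 1) + g ^ 2]. The two terms of [E] bound
    [2 (w g + 1)], by the first moment, and [g ^ 2], by the total mass; both bounds decrease in
    [Im w], so the value at the starting height [Y] serves at every step. *)
Lemma iter_F_transform_sqr (R : realType) (mu : probability (measurableTypeR R) R)
    (nu : {finite_measure set (measurableTypeR R) -> \bar R}) (c X Y : R) (n : nat)
    (w := iter n (F_transform mu) (Complex X Y)) (E := 2 * (c / Y) + Y^-1 ^+ 2) :
  0 < Y -> nevanlinna_measure mu nu -> (\int[nu]_t (`|t|)%:E)%E = c%:E ->
  [/\ Y <= complex.Im w,
      `|complex.Re w ^+ 2 - complex.Im w ^+ 2 - (X ^+ 2 - Y ^+ 2 - 2 * n%:R)| <= n%:R * E &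
      `|2 * (complex.Re w * complex.Im w) - 2 * (X * Y)| <= n%:R * E].
Proof.
move=> Y0 [nu1 repr] moment; rewrite {}/w.
have c0 : 0 <= c by rewrite -lee_fin -moment integral_ge0.
elim: n => [|n]; first by rewrite /= mul0r mulr0 subr0 !subrr normr0.
rewrite iterS; set w := iter n _ _; case: w => a b IH.
have b0 : 0 < b by case: IH => /= Yb _ _; exact: lt_le_trans Yb.
rewrite repr // (Cintegral_stieltjes nu a b); move: IH => /= [Yb IR II].
have := stieltjes_moment_Re a b0 nu1 moment; have := stieltjes_moment_Im a b0 moment.
have := poisson_ge0 nu a b0; have := poisson_le a b0 nu1; have := conj_poisson_le a b0 nu1.
set G := Rintegral _ _ _; set H := Rintegral _ _ _ => /= G1 H1 H0 MI MR.
have ib0 : 0 < b^-1 by rewrite invr_gt0.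
have cb : c / b <= c / Y by rewrite ler_wpM2l// lef_pV2.
have bY : b^-1 ^+ 2 <= Y^-1 ^+ 2.
  by rewrite lerXn2r ?nnegrE ?invr_ge0 ?(ltW b0) ?(ltW Y0)// lef_pV2.
have hb : (2 * b)^-1 = b^-1 / 2 by field; rewrite gt_eqF.
move: G1; rewrite hb !ler_norml => /andP[Gl Gu].
move: MI MR IR II; rewrite !ler_norml => /andP[MIl MIu] /andP[MRl MRu].
move=> /andP[IRl IRu] /andP[IIl IIu].
have G2 : G ^+ 2 <= b^-1 ^+ 2 by nra.
have H2 : H ^+ 2 <= b^-1 ^+ 2 by nra.
have GHu : 2 * (G * H) <= b^-1 ^+ 2 by nra.
have GHl : - (b^-1 ^+ 2) <= 2 * (G * H) by nra.
have G20 := sqr_ge0 G; have H20 := sqr_ge0 H.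
have -> : n.+1%:R * E = n%:R * E + (2 * (c / Y) + Y^-1 ^+ 2).
  by rewrite -(natr1 n) mulrDl mul1r.
rewrite -(natr1 n); split; first by lra.
  have -> : (a + G) ^+ 2 - (b + H) ^+ 2 - (X ^+ 2 - Y ^+ 2 - 2 * (n%:R + 1)) =
    (a ^+ 2 - b ^+ 2 - (X ^+ 2 - Y ^+ 2 - 2 * n%:R)) + 2 * (a * G - b * H + 1) +
    (G ^+ 2 - H ^+ 2) by ring.
  by apply/andP; split; lra.
have -> : 2 * ((a + G) * (b + H)) - 2 * (X * Y) =
  (2 * (a * b) - 2 * (X * Y)) + 2 * (a * H + b * G) + 2 * (G * H) by ring.
by apply/andP; split; lra.
Qed.

(** * Cauchy smoothing of a distribution function *)

Lemma is_derive_of_quadratic_error (R : realType) (f : R -> R) (x D K : R) :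
  (forall x', `|f x' - f x - (x' - x) * D| <= K * (x' - x) ^+ 2) -> is_derive x 1 f D.
Proof.
move=> H.
have cf : (fun h : R => h^-1 *: ((f \o shift x) (h *: 1) - f x)) @ 0^' --> D.
  apply/cvgrPdist_le => e e0; near=> h.
  have h0 : h != 0 by near: h; exact: nbhs_dnbhs_neq.
  have hk : `|h| * (`|K| + 1) <= e.
    rewrite -ler_pdivlMr ?ltr_wpDl//; near: h; apply: dnbhs0_le.
    by rewrite divr_gt0// ltr_wpDl.
  have := H (h + x); rewrite addrK => Hh.
  have -> : D - h^-1 *: ((f \o shift x) (h *: 1) - f x) =
     - (h^-1 * (f (h + x) - f x - h * D)).
    have -> : (f \o shift x) (h *: 1) = f (h + x) by rewrite /= [h *: 1]mulr1.
    by rewrite /GRing.scale /=; field.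
  rewrite normrN normrM normfV ler_pdivrMl ?normr_gt0//.
  apply: (le_trans Hh); rewrite -real_normK ?num_real//.
  have := normr_gt0 h; rewrite h0 => hp; have := ler_norm K; nra.
apply: DeriveDef; first by apply: cvgP cf.
exact: cvg_lim cf.
Unshelve. all: by end_near. Qed.

Definition cdf_at (R : realType) (m : set (measurableTypeR R) -> \bar R) (x : R) : R :=
  fine (m `]-oo, x]%classic).

Section smoothed_cdf.
Variables (R : realType) (m : probability (measurableTypeR R) R).

(** The integrand is the Cauchy distribution function of scale [Y], so this is the distribution
    function of the convolution of [m] with that law. *)
Definition smoothed_cdf (Y X : R) : R :=
  Rintegral m setT (fun t => 2^-1 + atan ((X - t) / Y) / pi).

Lemma integrable_smoothed_cdf (Y X : R) :
  m.-integrable setT (EFin \o (fun t => 2^-1 + atan ((X - t) / Y) / pi)).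
Proof.
have p0 := pi_gt0 R.
apply: (@bounded_continuous_integrable _ m _ 1).
  move=> t; apply: cvgD; first exact: cvg_cst.
  apply: cvgM; last exact: cvg_cst.
  apply: (@continuous_comp _ _ _ (fun t => (X - t) / Y) atan); last exact: continuous_atan.
  by apply: cvgM; [apply: cvgB; [exact: cvg_cst|exact: cvg_id]|exact: cvg_cst].
move=> t; have := atan_gtNpi2 ((X - t) / Y); have := atan_ltpi2 ((X - t) / Y).
set s := atan _ => h1 h2; rewrite ler_norml.
have : s / pi <= 2^-1 by rewrite ler_pdivrMr//; lra.
have : - 2^-1 <= s / pi by rewrite ler_pdivlMr//; lra.
by move=> h3 h4; apply/andP; split; lra.
Qed.

(** The quadratic remainder of the arctangent is uniform in [t]; integrating it against a
    probability bounds the increment directly, with no limit taken under the integral. *)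
Lemma is_derive_smoothed_cdf (Y X : R) : 0 < Y ->
  is_derive X 1 (smoothed_cdf Y)
    (Rintegral m setT (fun t => Y / ((t - X) ^+ 2 + Y ^+ 2)) / pi).
Proof.
move=> Y0; have p0 := pi_gt0 R.
set D := _ / pi.
pose K := (Y ^+ 2 * pi)^-1.
have K0 : 0 < K by rewrite invr_gt0 mulr_gt0 ?exprn_gt0.
have taylor X' : `|smoothed_cdf Y X' - smoothed_cdf Y X - (X' - X) * D| <= K * (X' - X) ^+ 2.
  pose g Z t := 2^-1 + atan ((Z - t) / Y) / pi.
  pose P t := Y / ((t - X) ^+ 2 + Y ^+ 2).
  have IP : m.-integrable setT (EFin \o (fun t => ((X' - X) / pi) * P t)).
    by have := integrableZl measurableT ((X' - X) / pi) (integrable_poisson m X Y0);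
      apply: eq_integrable.
  have Ig : m.-integrable setT (EFin \o (fun t => g X' t - g X t)).
    by have := integrableB measurableT (integrable_smoothed_cdf Y X')
      (integrable_smoothed_cdf Y X); apply: eq_integrable.
  have I : m.-integrable setT (EFin \o (fun t => g X' t - g X t - (X' - X) / pi * P t)).
    by have := integrableB measurableT Ig IP; apply: eq_integrable.
  have -> : smoothed_cdf Y X' - smoothed_cdf Y X - (X' - X) * D =
     Rintegral m setT (fun t => g X' t - g X t - (X' - X) / pi * P t).
    rewrite RintegralB// RintegralB//; [|exact: integrable_smoothed_cdf..].
    rewrite RintegralZl//; last exact: integrable_poisson.
    by congr (_ - _); rewrite /D; ring.
  rewrite -[leRHS](@Rintegral_cst1 _ m (probability_setT m)).
  apply: normr_Rintegral_le => //; first exact: finite_measure_integrable_cst.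
  move=> t; have := atan_taylor1 ((X - t) / Y) ((X' - t) / Y).
  have -> : (X' - t) / Y - (X - t) / Y = (X' - X) / Y by ring.
  have -> : (X' - X) / Y / (1 + ((X - t) / Y) ^+ 2) = (X' - X) * P t.
    by rewrite /P; field; rewrite !gt_eqF// ?denom_gt0//; have := exprn_gt0 2 Y0; nra.
  have -> : g X' t - g X t - (X' - X) / pi * P t =
    (atan ((X' - t) / Y) - atan ((X - t) / Y) - (X' - X) * P t) / pi.
    by rewrite /g; ring.
  rewrite normrM normfV (gtr0_norm p0) ler_pdivrMr// => /le_trans; apply.
  rewrite /K /= le_eqVlt; apply/orP; left; apply/eqP.
  by move: (pi : R) p0 => w w0; field; rewrite !gt_eqF.
exact: is_derive_of_quadratic_error taylor.
Qed.

(** [1 / F] is the Cauchy transform, and minus its imaginary part is the Poisson integral. This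
    links the F-transform to the density of the smoothed law. *)
Lemma smoothed_cdf_derive_F (X Y : R) : 0 < Y ->
  Rintegral m setT (fun t => Y / ((t - X) ^+ 2 + Y ^+ 2)) =
  complex.Im (F_transform m (Complex X Y)) /
   (complex.Re (F_transform m (Complex X Y)) ^+ 2 +
    complex.Im (F_transform m (Complex X Y)) ^+ 2).
Proof.
move=> Y0.
have E : - complex.Im (F_transform m (Complex X Y))^-1 =
    complex.Im (F_transform m (Complex X Y)) /
   (complex.Re (F_transform m (Complex X Y)) ^+ 2 +
    complex.Im (F_transform m (Complex X Y)) ^+ 2).
  by case: (F_transform _ _) => u v /=; rewrite opprK.
rewrite -{}E /F_transform invrK /Cintegral /=.
transitivity (- (-1 * Rintegral m setT (fun t => Y / ((t - X) ^+ 2 + Y ^+ 2)))).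
  by rewrite mulN1r opprK.
congr (- _); rewrite -RintegralZl//; last exact: integrable_poisson.
by apply: eq_Rintegral => t _; rewrite subr0 mulN1r -(opprB t X) sqrrN.
Qed.

(* [- c k] is the quantile of order [k / N] of the Cauchy law. *)
Lemma levels_atan (N : nat) (s : R)
    (c := fun k : nat => tan (pi / 2 - pi * k%:R / N%:R))
    (S := \sum_(1 <= k < N) (- c k <= s)%R%:R) :
  (0 < N)%N ->
  S <= N%:R * (2^-1 + atan s / pi) <= 1 + S.
Proof.
move=> N0; have p0 := pi_gt0 R.
have N0' : 0 < N%:R :> R by rewrite ltr0n.
pose H := N%:R * (2^-1 + atan s / pi).
have H0 : 0 <= H.
  rewrite mulr_ge0// -lerBlDl sub0r ler_pdivlMr//.
  by have := atan_gtNpi2 s; lra.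
have HN : H < N%:R.
  rewrite -[ltRHS]mulr1 ltr_pM2l//.
  have : atan s / pi < 2^-1 by rewrite ltr_pdivrMr//; have := atan_ltpi2 s; lra.
  by lra.
(* The sum counts the positive integers up to [H]; as [0 <= H < N], the range loses none of them and
   [S] is the integer part of [H]. *)
have SE : S = \sum_(1 <= k < N) (k <= Num.truncn H)%N%:R.
  apply: eq_big_nat => k /andP[k1 kN]; congr (_%:R); congr nat_of_bool.
  have kI : (pi : R) / 2 - pi * k%:R / N%:R \in `](- (pi / 2)), (pi / 2)[.
    have k0' : 0 < k%:R :> R by rewrite ltr0n.
    have kN' : k%:R < N%:R :> R by rewrite ltr_nat.
    have : 0 < (pi : R) * k%:R / N%:R by rewrite divr_gt0// mulr_gt0.
    have : (pi : R) * k%:R / N%:R < pi by rewrite ltr_pdivrMr// ltr_pM2l.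
    by move=> h1 h2; rewrite in_itv/=; apply/andP; split; lra.
  rewrite truncn_ge_nat//.
  have -> : (- c k <= s) = (atan (- c k) <= atan s).
    apply/idP/idP => [/le_atan//|]; apply: contraTT; rewrite -!ltNge; exact: lt_atan.
  rewrite atanN /c tanK// /H.
  have -> : (k%:R <= N%:R * (2^-1 + atan s / pi)) = (pi * k%:R / N%:R <= pi / 2 + atan s).
    rewrite ler_pdivrMr//.
    have -> : pi / 2 + atan s = pi * (2^-1 + atan s / pi).
      by rewrite mulrDr mulrCA divff ?gt_eqF// mulr1.
    by rewrite -mulrA ler_pM2l// mulrC.
  by apply/idP/idP => ?; lra.
have {}SE : S = (Num.truncn H)%:R.
  rewrite SE -natr_sum; congr (_%:R).
  have : (Num.truncn H < N)%N by rewrite truncn_lt_nat.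
  move: (Num.truncn H); clear -N0 => j; case: N N0 => // N _; rewrite ltnS.
  elim: N => [|N IH] jN; first by rewrite big_nil; lia.
  rewrite big_nat_recr//=; have [jN'|jN'] := leqP j N.
    by rewrite IH//; lia.
  have -> : j = N.+1 by lia.
  rewrite (eq_big_nat _ _ (F2 := fun=> 1%N)); last by move=> k /andP[_ kN]; rewrite (ltnW kN).
  by rewrite sum_nat_const_nat; lia.
rewrite SE -/H; have /andP[h1 h2] := truncn_itv H0.
by rewrite h1 /= addrC natr1 ltW.
Qed.

Lemma integral_sum_le_indicator (N : nat) (x : nat -> R) :
  m.-integrable setT (EFin \o (fun t => \sum_(1 <= k < N) (t <= x k)%R%:R)) /\
  Rintegral m setT (fun t => \sum_(1 <= k < N) (t <= x k)%R%:R) =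
   \sum_(1 <= k < N) cdf_at m (x k).
Proof.
have [I0 R0] : m.-integrable setT (EFin \o cst (0 : R)) /\ Rintegral m setT (cst (0 : R)) = 0.
  by split; [exact: finite_measure_integrable_cst|rewrite Rintegral_cst// mul0r].
have Hz n : (n <= 1)%N ->
    m.-integrable setT (EFin \o (fun t => \sum_(1 <= k < n) (t <= x k)%R%:R)) /\
    Rintegral m setT (fun t => \sum_(1 <= k < n) (t <= x k)%R%:R) =
   \sum_(1 <= k < n) cdf_at m (x k).
  move=> n1; have -> : (fun t : R => \sum_(1 <= k < n) (t <= x k)%R%:R) = cst 0 :> (R -> R).
    by apply/funext => t; rewrite big_geq.
  by rewrite [X in _ = X]big_geq.
elim: N => [|N [I E]]; first exact: Hz.
have [N0|N0] := leqP N 0; first by apply: Hz; lia.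
have indE : (fun t => (t <= x N)%R%:R) = \1_(`]-oo, x N]%classic) :> (R -> R).
  by apply/funext => t; rewrite indicE mem_setE in_itv.
have Ind : m.-integrable setT (EFin \o (fun t => (t <= x N)%R%:R)).
  by rewrite indE; exact: integrable_indic.
have -> : (fun t : R => \sum_(1 <= k < N.+1) (t <= x k)%R%:R) =
   (fun t => \sum_(1 <= k < N) (t <= x k)%R%:R + (t <= x N)%R%:R) :> (R -> R).
  by apply/funext => t; rewrite big_nat_recr.
split; first by have := integrableD measurableT I Ind; apply: eq_integrable.
rewrite RintegralD// E big_nat_recr//=; congr (_ + _).
by rewrite indE /Rintegral integral_indic// setIT.
Qed.

(** Integrating the level count over [t] replaces the Cauchy law by equally weighted quantiles: the
    convolution becomes a finite average of values of the distribution function, with no exchange of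
    integrals, and the rounding costs at most one node. *)
Lemma smoothed_cdf_levels (N : nat) (Y X : R)
    (c := fun k : nat => tan (pi / 2 - pi * k%:R / N%:R) : R) :
  (0 < N)%N -> 0 < Y ->
  \sum_(1 <= k < N) cdf_at m (X + Y * c k) <= N%:R * smoothed_cdf Y X <=
    1 + \sum_(1 <= k < N) cdf_at m (X + Y * c k).
Proof.
move=> N0 Y0; have [I E] := integral_sum_le_indicator N (fun k => X + Y * c k).
rewrite -E /smoothed_cdf -RintegralZl//; last exact: integrable_smoothed_cdf.
have IN : m.-integrable setT (EFin \o (fun t => N%:R * (2^-1 + atan ((X - t) / Y) / pi))).
  by have := integrableZl measurableT N%:R (integrable_smoothed_cdf Y X); apply: eq_integrable.
have I1 : m.-integrable setT (EFin \o (cst (1 : R))) by exact: finite_measure_integrable_cst.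
have -> : 1 + Rintegral m setT (fun t => \sum_(1 <= k < N) (t <= X + Y * c k)%R%:R) =
   Rintegral m setT (fun t => cst 1 t + \sum_(1 <= k < N) (t <= X + Y * c k)%R%:R).
  rewrite RintegralD//; congr (_ + _); rewrite Rintegral_cst1//.
  exact: probability_setT.
have ID : m.-integrable setT
    (EFin \o (fun t => cst 1 t + \sum_(1 <= k < N) (t <= X + Y * c k)%R%:R)).
  by have := integrableD measurableT I1 I; apply: eq_integrable.
have key t : \sum_(1 <= k < N) (t <= X + Y * c k)%R%:R =
    \sum_(1 <= k < N) (- c k <= (X - t) / Y)%R%:R :> R.
  apply: eq_bigr => k _; congr (_%:R); congr nat_of_bool.
  by rewrite ler_pdivlMr// mulNr lerNl opprB lerBlDl mulrC.
by apply/andP; split; apply: le_Rintegral => // t _; rewrite key;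
  have /andP[] := levels_atan ((X - t) / Y) N0.
Qed.

Lemma cdf_at_bounds (x : R) : 0 <= cdf_at m x <= 1.
Proof.
rewrite /cdf_at fine_ge0//= -lee_fin fineK ?fin_num_measure// probability_le1//.
Qed.

Lemma cdf_at_mono (x y : R) : x <= y -> cdf_at m x <= cdf_at m y.
Proof.
move=> xy; rewrite /cdf_at fine_le ?fin_num_measure// le_measure ?inE//.
exact: subitvPr.
Qed.

Lemma cdf_at_small (e : R) : 0 < e -> exists x0, forall x, x <= x0 -> cdf_at m x <= e.
Proof.
move=> e0; pose F n : set (measurableTypeR R) := `]-oo, (- n%:R)%R]%classic.
have mF n : measurable (F n) by exact: measurable_itv.
have cv : m (F n) @[n --> \oo] --> 0%E.
  rewrite -(measure0 m); have <- : \bigcap_n F n = set0.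
    rewrite -subset0 => t /(_ (Num.truncn (- t)).+1 I).
    by rewrite /F/= in_itv/= leNgt => /negP; apply; rewrite ltrNl truncnS_gt.
  apply: nonincreasing_cvg_mu => //=.
  - by apply: (le_lt_trans (probability_le1 m (mF 0%N))); exact: ltry.
  - exact: bigcap_measurable.
  - move=> a b ab; apply/subsetPset => x; rewrite /F /= !in_itv/= => /le_trans; apply.
    by rewrite lerN2 ler_nat.
have nb : nbhs (0%E : \bar R) [set y | (y < e%:E)%E].
  apply: open_nbhs_nbhs; split; last by rewrite /= lte_fin.
  exact: open_ereal_lt_ereal.
have [N _ /(_ N (leqnn N)) HN] := cv _ nb.
exists (- N%:R) => x xN; apply: (le_trans (cdf_at_mono xN)).
by rewrite -lee_fin fineK ?fin_num_measure// ltW.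
Qed.

End smoothed_cdf.

(** * The arcsine distribution function *)

(** At height 0 the coordinate [cos theta] is [x / sqrt 2] clipped to [[-1, 1]]; the next two lemmas
    give the clipped ranges. *)
Lemma ellipse_cos0 (R : realType) (x : R) : `|x| <= Num.sqrt 2 ->
  ellipse_cos 0 x = x / Num.sqrt 2.
Proof.
have [r2 r14 r15] := sqrt2_bounds R; set r := Num.sqrt 2 in r2 r14 r15 *.
rewrite ler_norml => /andP[x1 x2].
rewrite /ellipse_cos /focal_dist -/r expr0n /= !addr0 !sqrtr_sqr.
by rewrite ger0_norm ?ler0_norm; [field|..]; lra.
Qed.

Lemma ellipse_cos0_ge (R : realType) (x : R) : Num.sqrt 2 <= x -> ellipse_cos 0 x = 1.
Proof.
have [r2 r14 r15] := sqrt2_bounds R; set r := Num.sqrt 2 in r2 r14 r15 * => x2.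
rewrite /ellipse_cos /focal_dist -/r expr0n /= !addr0 !sqrtr_sqr.
by rewrite !ger0_norm; [field|..]; lra.
Qed.

Lemma ellipse_cos0_le (R : realType) (x : R) : x <= - Num.sqrt 2 -> ellipse_cos 0 x = -1.
Proof.
have [r2 r14 r15] := sqrt2_bounds R; set r := Num.sqrt 2 in r2 r14 r15 * => x2.
rewrite /ellipse_cos /focal_dist -/r expr0n /= !addr0 !sqrtr_sqr.
by rewrite !ler0_norm; [field|..]; lra.
Qed.

Lemma arcsine_cdf0_le (R : realType) (x : R) : x <= - Num.sqrt 2 -> arcsine_cdf 0 x = 0.
Proof.
move=> /ellipse_cos0_le; rewrite /arcsine_cdf => ->.
by rewrite acosN1 divff ?subrr// gt_eqF ?pi_gt0.
Qed.

Lemma arcsine_cdf_bounds (R : realType) (y x : R) : 0 <= arcsine_cdf y x <= 1.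
Proof.
have p0 := pi_gt0 R; have kb := ellipse_cos_bounds y x.
rewrite /arcsine_cdf subr_ge0 ler_pdivrMr// mul1r acos_lepi//= gerBl.
by rewrite divr_ge0 ?acos_ge0// ltW.
Qed.

Lemma continuous_arcsine_cdf (R : realType) (y : R) : continuous (arcsine_cdf y).
Proof.
move=> x; apply/cvgrPdist_le => e e0; near=> z.
apply: (le_trans (arcsine_cdf_holder _ _ _)).
have : `|x - z| <= (e / 2) ^+ 2.
  by near: z; apply: cvgr_dist_le; [exact: cvg_id|rewrite exprn_gt0 ?divr_gt0].
move=> h; have h2 : Num.sqrt `|x - z| <= e / 2.
  have e2 : 0 <= e / 2 by rewrite divr_ge0// ltW.
  by rewrite -(ger0_norm e2) -(sqrtr_sqr (e / 2)) ler_sqrt// sqr_ge0.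
by nra.
Unshelve. all: by end_near. Qed.

Definition arcsine_density (R : realType) (t : R) : R := 1 / (pi * Num.sqrt (2 - t ^+ 2)).

Lemma is_derive_arcsine_cdf0 (R : realType) (t : R) : `|t| < Num.sqrt 2 ->
  is_derive t 1 (arcsine_cdf 0) (arcsine_density t).
Proof.
have [r2 r14 r15] := sqrt2_bounds R; move=> t2.
have tI : t \in `](- Num.sqrt 2), (Num.sqrt 2)[ by rewrite in_itv/= -ltr_norml.
apply: (@near_eq_is_derive _ _ _ (cst 1 - (acos \o (fun t => t / Num.sqrt 2)) * cst pi^-1)).
- near=> z; rewrite /arcsine_cdf ellipse_cos0//.
  by rewrite ltW// ltr_norml; near: z; exact: near_in_itvoo.
have dl : is_derive t 1 (fun t => t / Num.sqrt 2) (Num.sqrt 2)^-1.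
  have := @is_deriveM _ _ id (cst (Num.sqrt 2)^-1) t 1 _ _ (is_derive_id _ _) (is_derive_cst _ _ _).
  move=> h; apply: is_derive_eq h _; by rewrite scaler0 add0r [LHS]mulr1.
move: t2; set r := Num.sqrt 2 in r2 r14 r15 tI dl *; rewrite ltr_norml => /andP[t1 t2].
have tr : -1 < t / r < 1 by rewrite ltr_pdivlMr ?ltr_pdivrMr; lra.
have h1 := @is_derive1_comp _ acos _ t _ _ (is_derive1_acos tr) dl.
have := @is_deriveB _ _ _ _ _ _ _ _ _ (is_derive_cst (1 : R) t 1)
  (@is_deriveM _ _ _ (cst (pi : R)^-1) t 1 _ _ h1 (is_derive_cst _ _ _)).
move=> h; apply: is_derive_eq h _.
transitivity (- (pi^-1 * (- (Num.sqrt (1 - (t / r) ^+ 2))^-1 * r^-1))).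
  have E0 (a b : R) : a * 0 + b = b by rewrite mulr0 add0r.
  by rewrite -[RHS]sub0r; exact: (congr1 (fun w => 0 - w) (E0 _ _)).
have -> : arcsine_density t = pi^-1 * ((Num.sqrt (1 - (t / r) ^+ 2))^-1 * r^-1).
  rewrite /arcsine_density mul1r invfM; congr (_ * _); rewrite -invfM; congr (_^-1).
  rewrite -[X in _ * X]ger0_norm; last lra.
  rewrite -sqrtr_sqr -sqrtrM; last by nra.
  by congr Num.sqrt; rewrite mulrBl mul1r expr_div_n divfK ?r2//.
by rewrite mulNr mulrN opprK.
Unshelve. all: by end_near. Qed.

Lemma continuous_arcsine_density (R : realType) (t : R) : `|t| < Num.sqrt 2 ->
  {for t, continuous (@arcsine_density R)}.
Proof.
move=> t2; have r2 : Num.sqrt 2 ^+ 2 = 2 :> R by rewrite sqr_sqrtr.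
have d0 : 0 < 2 - t ^+ 2.
  by rewrite subr_gt0 -r2 -(real_normK (num_real t)) ltrXn2r// nnegrE.
apply: cvgM; first exact: cvg_cst.
apply: cvgV; first by rewrite mulf_neq0 ?gt_eqF ?pi_gt0 ?sqrtr_gt0.
apply: cvgM; first exact: cvg_cst.
apply: continuous_cvg; first exact: sqrt_continuous.
by apply: cvgB; [exact: cvg_cst|exact: exprn_continuous].
Qed.

(** The density is unbounded at the edges, so the integral is exhausted by compact intervals inside
    []- r, r[]: monotone convergence gives one limit, the fundamental theorem and the continuity of
    [arcsine_cdf 0] give the other. *)
Lemma arcsine_cdfE (R : realType) (x : R) :
  arcsine `]-oo, x]%classic = (arcsine_cdf 0 x)%:E.
Proof.
have [r2 r14 r15] := sqrt2_bounds R.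
set r := Num.sqrt 2 in r2 r14 r15 *.
(* The shift by 2 keeps [q n] positive already at [n = 0]. *)
pose q (n : nat) : R := r * (1 - n.+2%:R^-1).
have q_lt n : 0 < q n < r.
  have h : 0 < n.+2%:R^-1 :> R by rewrite invr_gt0.
  have h2 : n.+2%:R^-1 <= 2^-1 :> R by rewrite lef_pV2 ?posrE// ler_nat.
  have r0 : 0 < r by lra.
  have := mulr_gt0 r0 h; have := ler_wpM2l (ltW r0) h2.
  by rewrite /q mulrBr mulr1; set w := r / n.+2%:R => h3 h4; apply/andP; split; lra.
have cq : q n @[n --> \oo] --> r.
  suff : q n @[n --> \oo] --> r * (1 - 0) by rewrite subr0 mulr1.
  apply: cvgM; first exact: cvg_cst.
  apply: cvgB; first exact: cvg_cst.
  have := @cvg_harmonic R; rewrite -cvg_shiftS; exact.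
have q_mono n k : (n <= k)%N -> q n <= q k.
  move=> nk; rewrite /q ler_wpM2l//; first lra.
  by rewrite lerD2l lerN2 lef_pV2 ?posrE// ler_nat !ltnS.
pose S n : set R := `[- q n, Num.min x (q n)]%classic.
have SE : \bigcup_n S n = `]-oo, x]%classic `&` `]- r, r[%classic.
  apply/seteqP; split => t /=; rewrite !in_itv/=.
    move=> [n _]; rewrite /S /= in_itv/= le_min => /and3P[h1 h2 h3].
    by have /andP[_ qr] := q_lt n; rewrite h2; split=> //; apply/andP; split; lra.
  move=> [tx tr]; have {}tr : `|t| < r by rewrite ltr_norml.
  have [N _ /(_ N (leqnn N))] := cvgr_ge _ cq _ tr.
  rewrite /= ler_norml => /andP[h1 h2]; exists N => //.
  by rewrite /S /= in_itv/= le_min tx h1 h2.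
have Sr n t : S n t -> `|t| < r.
  have /andP[_ qr] := q_lt n.
  rewrite /S /= in_itv/= le_min ltr_norml => /and3P[h1 h2 h3].
  by apply/andP; split; lra.
have cS n : {within S n, continuous (@arcsine_density R)}.
  by apply: continuous_in_subspaceT => t /set_mem /Sr; exact: continuous_arcsine_density.
have cv1 : (\int[@lebesgue_measure R]_(t in S n) (arcsine_density t)%:E @[n --> \oo] -->
    arcsine `]-oo, x]%classic)%E.
  rewrite /arcsine -SE; apply: ge0_nondecreasing_set_cvg_integral => //.
  - move=> n k nk; apply/subsetPset => t; rewrite /S /= !in_itv/= !le_min.
    by have := q_mono _ _ nk => h /and3P[h1 -> h3]; apply/and3P; split=> //; lra.
  - by move=> n; exact: measurable_itv.
  - move=> n; apply/measurable_EFinP; apply: subspace_continuous_measurable_fun => //.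
    exact: measurable_itv.
  - move=> n t _; rewrite lee_fin divr_ge0// mulr_ge0 ?pi_ge0 ?sqrtr_ge0//.
have cv2 : (\int[@lebesgue_measure R]_(t in S n) (arcsine_density t)%:E @[n --> \oo] -->
    (arcsine_cdf 0 x)%:E)%E.
  (* To the left of the support every [S n] is empty; otherwise the intervals are eventually
     nondegenerate, as the fundamental theorem requires. *)
  have [xr|xr] := leP x (- r).
    rewrite arcsine_cdf0_le//; apply: cvg_near_cst; apply: nearW => n.
    have -> : S n = set0.
      rewrite -subset0 => t; rewrite /S /= in_itv/= le_min => /and3P[h1 h2 h3].
      by have /andP[_ qr] := q_lt n; lra.
    by rewrite integral_set0.
  have xr' : - x < r by rewrite ltrNl.
  have H : \forall n \near \oo, (arcsine_cdf 0 (Num.min x (q n)) - arcsine_cdf 0 (- q n))%:E =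
     (\int[@lebesgue_measure R]_(t in S n) (arcsine_density t)%:E)%E.
    near=> n.
    have /andP[q0 qr] := q_lt n.
    have ab : - q n < Num.min x (q n).
      by rewrite lt_min ltrNl (_ : - q n < q n) ?andbT; [near: n; exact: cvgr_gt cq _ xr'|lra].
    have dF t : S n t -> is_derive t 1 (arcsine_cdf 0) (arcsine_density t).
      by move=> /Sr; exact: is_derive_arcsine_cdf0.
    apply/esym; rewrite (@continuous_FTC2 _ _ (arcsine_cdf 0) _ _ ab (cS n)) ?EFinB//.
      split; [|exact/cvg_at_right_filter/continuous_arcsine_cdf|
        exact/cvg_at_left_filter/continuous_arcsine_cdf].
      move=> t tI; have /dF[] : S n t by exact: subset_itv_oo_cc.
      by [].
    move=> t tI; have {}/dF h : S n t by exact: subset_itv_oo_cc.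
    by rewrite derive1E; exact: derive_val.
  apply: cvg_trans (near_eq_cvg H) _.
  apply: cvg_EFin; first exact: nearW.
  suff : arcsine_cdf 0 (Num.min x (q n)) - arcsine_cdf 0 (- q n) @[n --> \oo] -->
      arcsine_cdf 0 x - arcsine_cdf 0 (- r) by rewrite (@arcsine_cdf0_le _ (- r))// subr0.
  apply: cvgB; last first.
    apply: continuous_cvg; first exact: continuous_arcsine_cdf.
    exact: (cvgN cq).
  have [rx|rx] := leP r x.
    have -> : arcsine_cdf 0 x = arcsine_cdf 0 r.
      by rewrite /arcsine_cdf !ellipse_cos0_ge.
    have -> : (fun n => arcsine_cdf 0 (Num.min x (q n))) = (fun n => arcsine_cdf 0 (q n)).
      apply/funext => n; rewrite min_r//; have /andP[_ qr] := q_lt n; lra.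
    by apply: continuous_cvg; [exact: continuous_arcsine_cdf|exact: cq].
  apply: cvg_near_cst; near=> n; rewrite min_l//.
  by near: n; exact: cvgr_ge cq _ rx.
exact: (cvg_unique _ cv1 cv2).
Unshelve. all: by end_near. Qed.

(** * Removal of the Cauchy smoothing *)

Lemma cot_node_good (R : realType) (m k : nat) : (0 < k <= 3 * m)%N ->
  - 1 <= tan (pi / 2 - pi * k%:R / (4 * m)%:R) :> R.
Proof.
move=> /andP[k0 km]; have p0 := pi_gt0 R.
have m0 : 0 < (4 * m)%:R :> R by rewrite ltr0n; lia.
have k0' : 0 < k%:R :> R by rewrite ltr0n.
have h1 : (pi : R) * k%:R / (4 * m)%:R <= 3 / 4 * pi.
  have h : k%:R <= 3 * m%:R :> R by rewrite -natrM ler_nat.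
  by rewrite ler_pdivrMr// natrM; have := ler_wpM2l (ltW p0) h; lra.
have h2 : 0 < (pi : R) * k%:R / (4 * m)%:R by rewrite divr_gt0 ?mulr_gt0.
set th := _ - _; have thI : th \in `](- (pi / 2)), (pi / 2)[.
  by rewrite in_itv/=; apply/andP; split; rewrite /th; lra.
rewrite leNgt; apply/negP => /lt_atan; rewrite tanK// atanN atan1.
by rewrite /th; lra.
Qed.

(** The node is [- cot u] with [u = pi j / (4 m)]; [u <= tan u] bounds it by [1 / u], and [pi >= 2]
    gives the constant. *)
Lemma cot_node_bad (R : realType) (m j : nat) : (0 < j < m)%N ->
  `|tan (pi / 2 - pi * (4 * m - j)%:R / (4 * m)%:R)| <= 2 * m%:R / j%:R :> R.
Proof.
move=> /andP[j0 jm]; have p2 := pi_ge2 R; have p0 := pi_gt0 R.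
have m0 : 0 < m%:R :> R by rewrite ltr0n; lia.
have j0' : 0 < j%:R :> R by rewrite ltr0n.
have jm' : j%:R < m%:R :> R by rewrite ltr_nat.
pose u : R := pi * j%:R / (4 * m%:R).
have -> : (pi : R) / 2 - pi * (4 * m - j)%:R / (4 * m)%:R = u - pi / 2.
  rewrite /u natrB; last by lia.
  by rewrite natrM; move: (pi : R) => w; field; rewrite gt_eqF.
have u0 : 0 < u by rewrite divr_gt0 ?mulr_gt0.
have u2 : u < pi / 2.
  rewrite /u ltr_pdivrMr ?mulr_gt0//.
  have -> : (pi : R) / 2 * (4 * m%:R) = pi * (2 * m%:R) by move: (pi : R) => w; field.
  by rewrite ltr_pM2l//; lra.
have s0 : 0 < sin u by apply: sin_gt0_pi; lra.
have c0 : 0 < cos u by apply: cos_gt0_pihalf; lra.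
rewrite /tan sinBpihalf cosBpihalf mulNr normrN ger0_norm ?divr_ge0 ?(ltW s0) ?(ltW c0)//.
have tu : u <= tan u by apply: tan_ge; lra.
rewrite ler_pdivrMr//.
have h : u * cos u <= sin u by move: tu; rewrite /tan ler_pdivlMr.
have -> : 2 * m%:R / j%:R * sin u = (2 * m%:R * sin u) / j%:R by ring.
rewrite ler_pdivlMr//.
have uj : j%:R <= 2 * m%:R * u.
  have -> : 2 * m%:R * u = j%:R * (pi / 2).
    by rewrite /u; move: (pi : R) => w; field; rewrite gt_eqF.
  by have := ler_wpM2l (ltW j0') p2; lra.
apply: (@le_trans _ _ (2 * m%:R * (u * cos u))).
  by have := ler_wpM2r (ltW c0) uj; lra.
by rewrite ler_wpM2l// mulr_ge0// ltW.
Qed.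

(* [N = 4 m] equally weighted nodes [y cot(pi k / N)] replace the Cauchy kernel
   of scale [y]: three quarters of them lie to the right of [- y]. *)
Lemma smoothing_upper (R : realType) (M G : R -> R) (K D d y : R) (m : nat)
    (c := fun k : nat => tan (pi / 2 - pi * k%:R / (4 * m)%:R) : R) :
  (0 < m)%N -> 0 < y -> 0 <= K -> 0 <= D ->
  {homo M : x z / x <= z} ->
  (forall x, 0 <= G x <= 1) ->
  (forall x z, `|G x - G z| <= K * Num.sqrt `|x - z|) ->
  (forall x, G x - M x <= D) ->
  (forall x, \sum_(1 <= k < 4 * m) M (x + y * c k) <= (4 * m)%:R * (G x + d)) ->
  forall x, M x - G x <=
    D / 3 + 4 / 3 * d + 2 * (K * Num.sqrt y) + (3 * m%:R)^-1.
Proof.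
move=> m0 y0 K0 D0 Mmono Gb Gh GM Hs x.
have m0' : 0 < m%:R :> R by rewrite ltr0n.
(* Seen from [X], a node at least [- 1] lands to the right of [x], where [M] is at least [M x]. *)
pose X := x + y.
have GXx : `|G X - G x| <= K * Num.sqrt y.
  by apply: (le_trans (Gh _ _)); rewrite /X addrAC subrr add0r gtr0_norm.
have good : (3 * m)%:R * M x <= \sum_(1 <= k < (3 * m).+1) M (X + y * c k).
  have -> : (3 * m)%:R * M x = \sum_(1 <= k < (3 * m).+1) M x.
    by rewrite sumr_const_nat subn1 /= mulr_natl.
  rewrite !big_nat; apply: ler_sum => k kI; apply: Mmono.
  have : - 1 <= c k by apply: cot_node_good; lia.
  by rewrite /X; nra.
(* On the left quarter only [M >= G - D] is available. There [G] drops by at most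
   [K sqrt (2 y m / j)], and the sum of [1 / sqrt j] is of order [sqrt m]; the factor 3 bounds
   [2 sqrt 2]. *)
have bad : (m.-1)%:R * (G X - D) - 3 * (m%:R * (K * Num.sqrt y)) <=
    \sum_(1 <= j < m) M (X + y * c (4 * m - j)%N).
  pose T : R := \sum_(1 <= j < m) (K * (Num.sqrt (2 * y * m%:R) * (Num.sqrt j%:R)^-1)).
  have TE : T <= 3 * (m%:R * (K * Num.sqrt y)).
    have S1 := sum_invsqrt_le R m.-1; rewrite prednK// in S1.
    have S2 : \sum_(1 <= j < m) (Num.sqrt j%:R)^-1 <= 2 * Num.sqrt m%:R :> R.
      by apply: (le_trans S1); rewrite ler_wpM2l// ler_sqrt// ler_nat leq_pred.
    rewrite /T -!mulr_sumr.
    have S3 := ler_wpM2l (sqrtr_ge0 (2 * y * m%:R)) S2.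
    apply: (le_trans (ler_wpM2l K0 S3)).
    have [_ _ r15] := sqrt2_bounds R.
    have em : Num.sqrt m%:R ^+ 2 = m%:R :> R by rewrite sqr_sqrtr.
    rewrite !sqrtrM ?mulr_ge0 ?(ltW y0)//.
    have -> : K * (Num.sqrt 2 * Num.sqrt y * Num.sqrt m%:R * (2 * Num.sqrt m%:R)) =
      (2 * Num.sqrt 2) * (Num.sqrt m%:R ^+ 2 * (K * Num.sqrt y)) by ring.
    by rewrite em; apply: ler_wpM2r; [rewrite !mulr_ge0 ?sqrtr_ge0|lra].
  have -> : (m.-1)%:R * (G X - D) = \sum_(1 <= j < m) (G X - D).
    by rewrite sumr_const_nat subn1 mulr_natl.
  apply: (@le_trans _ _ (\sum_(1 <= j < m) (G X - D) - T)); first by rewrite lerD2l lerN2.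
  rewrite /T -sumrB !big_nat; apply: ler_sum => j jI.
  have cb : `|c (4 * m - j)%N| <= 2 * m%:R / j%:R by exact: cot_node_bad.
  have := GM (X + y * c (4 * m - j)%N); have := Gh (X + y * c (4 * m - j)%N) X.
  have -> : X + y * c (4 * m - j)%N - X = y * c (4 * m - j)%N by ring.
  rewrite ler_norml => /andP[h1 _] h2.
  suff : Num.sqrt `|y * c (4 * m - j)%N| <= Num.sqrt (2 * y * m%:R) * (Num.sqrt j%:R)^-1.
    by move=> h3; have := ler_wpM2l K0 h3; lra.
  rewrite -sqrtrV// -sqrtrM ?mulr_ge0 ?(ltW y0)// ler_sqrt ?mulr_ge0 ?invr_ge0 ?(ltW y0)//.
  by rewrite normrM gtr0_norm//; have := ler_wpM2l (ltW y0) cb; lra.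
have split : \sum_(1 <= k < 4 * m) M (X + y * c k) =
  \sum_(1 <= k < (3 * m).+1) M (X + y * c k) + \sum_(1 <= j < m) M (X + y * c (4 * m - j)%N).
  rewrite (@big_cat_nat _ _ _ (3 * m).+1)/=; [|lia..]; congr (_ + _).
  rewrite -[(3 * m).+1]/(1 + 3 * m)%N big_addn [RHS]big_nat_rev /=.
  have -> : (4 * m - 3 * m = m)%N by lia.
  by apply: eq_big_nat => j jI; rewrite (_ : (4 * m - (1 + m - j.+1) = j + 3 * m)%N)//; lia.
have := Hs X; rewrite split => H.
have := GM X; have /andP[GX0 GX1] := Gb X.
move: GXx; rewrite ler_norml => /andP[g1 g2].
have mE : (m.-1)%:R = m%:R - 1 :> R by rewrite -subn1 natrB.
rewrite mE in bad.
move: good bad H; rewrite !natrM.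
set A := \sum_(1 <= k < _) _; set B := \sum_(1 <= k < m) _ => good bad H h.
set W := K * Num.sqrt y in bad g1 g2 *.
(* There are only [4 m - 1] nodes; the missing one leaves a term [G X <= 1], hence the final 1. *)
have key : (M x - G X) * (3 * m%:R) <= m%:R * D + 4 * m%:R * d + 3 * (m%:R * W) + 1.
  lra.
move: key; rewrite -ler_pdivlMr ?mulr_gt0//.
have -> : (m%:R * D + 4 * m%:R * d + 3 * (m%:R * W) + 1) / (3 * m%:R) =
  D / 3 + 4 / 3 * d + W + (3 * m%:R)^-1.
  by field; rewrite gt_eqF.
by set z := (_ * m%:R)^-1; lra.
Qed.

(** With [D] the supremum of [|M - G|], the one-sided bound and its mirror image under [x -> - x]
    give [D <= D / 3 + ...]; solving for [D] multiplies the remaining terms by 3/2. *)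
Lemma smoothing_inequality (R : realType) (M G S : R -> R) (K d y : R) (m : nat)
    (c := fun k : nat => tan (pi / 2 - pi * k%:R / (4 * m)%:R) : R) :
  (0 < m)%N -> 0 < y -> 0 <= K ->
  {homo M : x z / x <= z} ->
  (forall x, 0 <= M x <= 1) -> (forall x, 0 <= G x <= 1) ->
  (forall x z, `|G x - G z| <= K * Num.sqrt `|x - z|) ->
  (forall x, \sum_(1 <= k < 4 * m) M (x + y * c k) <= (4 * m)%:R * S x <=
     1 + \sum_(1 <= k < 4 * m) M (x + y * c k)) ->
  (forall x, `|S x - G x| <= d) ->
  forall x, `|M x - G x| <= 2 * d + 3 * (K * Num.sqrt y) + (2 * m%:R)^-1.
Proof.
move=> m0 y0 K0 Mmono Mb Gb Gh HS Sd.
have m0' : 0 < m%:R :> R by rewrite ltr0n.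
pose A := [set `|M x - G x| | x in [set: R]].
have ubA : has_ubound A.
  exists 1 => _ [x _ <-]; have /andP[a1 a2] := Mb x; have /andP[b1 b2] := Gb x.
  by rewrite ler_norml; apply/andP; split; lra.
pose D := sup A.
have DA x : `|M x - G x| <= D.
  by apply: sup_upper_bound; [split; [exists `|M 0 - G 0|; exists 0|]|exists x].
have D0 : 0 <= D by exact: le_trans (DA 0).
have cN k : (1 <= k < 4 * m)%N -> c (4 * m - k)%N = - c k.
  move=> kI; rewrite /c -tanN; congr tan; rewrite natrB; last by lia.
  by move: (pi : R) => w; rewrite natrM; field; rewrite gt_eqF.
pose B := D / 3 + 4 / 3 * d + 2 * (K * Num.sqrt y) + (3 * m%:R)^-1.
have up x : M x - G x <= B.
  apply: smoothing_upper => // z.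
    by have := DA z; rewrite ler_norml => /andP[h _]; lra.
  have /andP[h1 _] := HS z; apply: (le_trans h1); rewrite ler_wpM2l//.
  by have := Sd z; rewrite ler_norml => /andP[_ h]; lra.
have lo x : G x - M x <= B.
  have := @smoothing_upper _ (fun z => 1 - M (- z)) (fun z => 1 - G (- z)) K D d y m
    m0 y0 K0 D0 _ _ _ _ _ (- x).
  rewrite opprK (_ : 1 - M x - (1 - G x) = G x - M x); last by ring.
  apply.
  - by move=> u v uv; rewrite lerD2l lerN2; apply: Mmono; rewrite lerN2.
  - by move=> z; have /andP[b1 b2] := Gb (- z); apply/andP; split; lra.
  - move=> u v; rewrite (_ : 1 - G (- u) - (1 - G (- v)) = G (- v) - G (- u)); last by ring.
    by apply: (le_trans (Gh _ _)); rewrite (_ : - v - - u = u - v)//; ring.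
  - by move=> z; have := DA (- z); rewrite ler_norml => /andP[_ h]; lra.
  move=> z.
  (* The nodes are symmetric. The sum has [4 m - 1] terms, and the deficit of 1 is exactly the
     rounding term in the upper bound of [HS]. *)
  have -> : \sum_(1 <= k < 4 * m) (1 - M (- (z + y * c k))) =
      (4 * m).-1%:R - \sum_(1 <= k < 4 * m) M (- z + y * c k).
    rewrite big_split /= sumr_const_nat subn1 sumrN; congr (_ - _).
    rewrite big_nat_rev /=; apply: eq_big_nat => k kI.
    rewrite (_ : (1 + 4 * m - k.+1 = 4 * m - k)%N); last by lia.
    by rewrite cN//; congr M; ring.
  have /andP[_ h1] := HS (- z).
  have := Sd (- z); rewrite ler_norml => /andP[h2 h3].
  have mE : ((4 * m).-1)%:R = (4 * m)%:R - 1 :> R by rewrite -subn1 natrB//; lia.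
  have m4 : 0 <= (4 * m)%:R :> R by [].
  have : (4 * m)%:R * (G (- z) - d) <= (4 * m)%:R * S (- z) by rewrite ler_wpM2l//; lra.
  by rewrite mE; set W := \sum_(_ <= _ < _) _ in h1 *; lra.
have DB : D <= B.
  apply: ge_sup; first by exists `|M 0 - G 0|; exists 0.
  move=> _ [x _ <-]; rewrite ler_norml; have := up x; have := lo x => h1 h2.
  by apply/andP; split; lra.
move=> x; apply: (le_trans (DA x)); move: DB; rewrite /B.
have -> : (3 * m%:R)^-1 = 2 / 3 * (2 * m%:R)^-1 :> R by field; rewrite gt_eqF.
by set z := (2 * m%:R)^-1; lra.
Qed.

(** * Comparison of the smoothed distribution functions *)

Lemma is_derive_ge0_homo (R : realType) (f df : R -> R) :
  (forall x : R, is_derive x 1 f (df x)) -> (forall x, 0 <= df x) ->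
  {homo f : x y / x <= y}.
Proof.
move=> Df df0 x y xy.
have cf : {within `[x, y], continuous f}.
  apply: continuous_subspaceT => z; apply: differentiable_continuous.
  by apply/derivable1_diffP; have [] := Df z.
have [z _ E] := MVT_segment xy (fun z _ => Df z) cf.
by rewrite -subr_ge0 E mulr_ge0// subr_ge0.
Qed.

Lemma smoothed_cdf_ge0 (R : realType) (m : probability (measurableTypeR R) R) (Y X : R) :
  0 < Y -> 0 <= smoothed_cdf m Y X.
Proof.
by move=> Y0; have /andP[] := smoothed_cdf_levels m X (ltn0Sn 0) Y0; rewrite big_geq// mul1r.
Qed.

(** Anchors the comparison of derivatives at [- oo]. With [N >= 2 / e] nodes the rounding
    contributes at most [e / 2], and far enough to the left all the shifted arguments are in the
    small tail. *)
Lemma smoothed_cdf_small (R : realType) (m : probability (measurableTypeR R) R) (Y e : R) :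
  0 < Y -> 0 < e -> exists X0, forall X, X <= X0 -> smoothed_cdf m Y X <= e.
Proof.
move=> Y0 e0; have e2 : 0 < e / 2 by rewrite divr_gt0.
have [x0 small] := cdf_at_small m e2.
pose N := (Num.truncn (2 / e)).+1.
pose c k : R := tan (pi / 2 - pi * k%:R / N%:R).
pose C := \sum_(1 <= k < N) `|c k|.
have N0 : 0 < N%:R :> R by rewrite ltr0n.
exists (x0 - Y * C) => X XC.
have /andP[_] := smoothed_cdf_levels m X (ltn0Sn _ : (0 < N)%N) Y0; rewrite -/(c _).
set S := \sum_(_ <= _ < _) _ => h.
have S1 : S <= N%:R * (e / 2).
  apply: (@le_trans _ _ (\sum_(1 <= k < N) (e / 2))).
    rewrite /S !big_nat; apply: ler_sum => k kI; apply: small.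
    have : c k <= C.
      rewrite (le_trans (ler_norm _))// /C (big_rem k) ?mem_index_iota//= lerDl.
      by apply: sumr_ge0.
    by rewrite -/(c k) => h1; have := ler_wpM2l (ltW Y0) h1; lra.
  have -> : \sum_(1 <= k < N) (e / 2) = (N - 1)%:R * (e / 2).
    by rewrite sumr_const_nat mulr_natl.
  by rewrite ler_wpM2r ?(ltW e2)// ler_nat; lia.
have N2 : 1 <= N%:R * (e / 2).
  have := truncnS_gt (2 / e); rewrite -/N ltr_pdivrMr// => ?; lra.
by rewrite -(ler_pM2l N0); lra.
Qed.

(** The variation of the difference is dominated by that of [k (Phi (- r) + Phi r)], which is at
    most [k pi = 5 sqrt y]; the rest of the constant covers the value at a far left point. The
    factor 7/10 satisfies [2 (7 / 10) ^ 2 <= 1], so the two components together have modulus at most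
    [y]. *)
Lemma smoothed_cdf_arcsine (R : realType) (m : probability (measurableTypeR R) R) (s y : R)
    (u := fun x => complex.Re (F_transform m (Complex (s * x) (s * y))))
    (v := fun x => complex.Im (F_transform m (Complex (s * x) (s * y)))) :
  0 < s -> 0 < y ->
  (forall x, [/\ 0 < v x,
    `|u x ^+ 2 - v x ^+ 2 - s ^+ 2 * (x ^+ 2 - y ^+ 2 - 2)| <= s ^+ 2 * (7 / 10 * y) &
    `|2 * (u x * v x) - s ^+ 2 * (2 * (x * y))| <= s ^+ 2 * (7 / 10 * y)]) ->
  forall x, `|smoothed_cdf m (s * y) (s * x) - arcsine_cdf y x| <= 15 / 2 * Num.sqrt y.
Proof.
move=> s0 y0 Huv; have p0 := pi_gt0 R.
have [r2 r14 r15] := sqrt2_bounds R; pose r : R := Num.sqrt 2; rewrite -/r in r2 r14 r15.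
pose Phi a x := atan (Num.sqrt ((focal_dist a y x + (x - a)) / y)).
have Phib a x : 0 <= Phi a x <= pi / 2.
  rewrite /Phi -{1}atan0 le_atan ?sqrtr_ge0//=; exact/ltW/atan_ltpi2.
pose H x := smoothed_cdf m (s * y) (s * x) - arcsine_cdf y x.
(* The perturbation bound [5 / 4 y / rho ^ (3 / 2)] is [5 sqrt y] times the lower bound
   [sqrt y / (4 rho ^ (3 / 2))] for the derivative of [Phi]. *)
pose k : R := 5 * Num.sqrt y / pi.
have k0 : 0 <= k by rewrite divr_ge0 ?(ltW p0)// mulr_ge0 ?sqrtr_ge0.
have Y0 : 0 < s * y by rewrite mulr_gt0.
have dH (x : R) : exists h e : R, [/\ is_derive x 1 H h,
    is_derive x 1 (fun x => Phi (- r) x + Phi r x) e & `|h| <= k * e].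
  have [p [q [q0 Epq Epq' EW dQ]]] := is_derive_arcsine_cdf x y0; rewrite -/r in EW.
  have [d1 D1 l1] := is_derive_atan_sqrt_focal (- r) x y0.
  have [d2 D2 l2] := is_derive_atan_sqrt_focal r x y0.
  have A0 := focal_dist_gt0 (- r) x y0; have B0 := focal_dist_gt0 r x y0.
  have [v0 Ere Eim] := Huv x.
  have dM := is_derive_smoothed_cdf m (s * x) Y0.
  have dl : is_derive x 1 (fun x => s * x) s.
    have := @is_deriveZ _ _ _ id s x 1 _ (is_derive_id _ _).
    by move=> h; apply: is_derive_eq h _; rewrite [LHS]mulr1.
  have dS := @is_derive1_comp _ _ _ x _ _ dM dl.
  (* [U + i V] is the F-transform, at [x + i y], of the measure dilated by [s]. *)
  pose U := u x / s; pose V := v x / s.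
  have sn : s != 0 by rewrite gt_eqF.
  have DE : Rintegral m setT (fun t => s * y / ((t - s * x) ^+ 2 + (s * y) ^+ 2)) / pi * s =
      V / (U ^+ 2 + V ^+ 2) / pi.
    rewrite smoothed_cdf_derive_F// -/(u x) -/(v x).
    have -> : u x = s * U by rewrite /U; field.
    have -> : v x = s * V by rewrite /V; field.
    have V0 : 0 < V by rewrite divr_gt0.
    have UV : U ^+ 2 + V ^+ 2 != 0 by rewrite gt_eqF//; have := exprn_gt0 2 V0; nra.
    have -> : (s * U) ^+ 2 + (s * V) ^+ 2 = s ^+ 2 * (U ^+ 2 + V ^+ 2) by ring.
    by move: (_ + _) UV => w wn; move: (pi : R) p0 => t t0; field; rewrite wn sn gt_eqF.
  rewrite DE in dS.
  have dHx := is_deriveB dS dQ.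
  have dP := is_deriveD D1 D2.
  eexists; eexists; split; [exact: dHx|exact: dP|].
  pose rho := Num.min (focal_dist (- r) y x) (focal_dist r y x).
  have rl : Num.sqrt y / (4 * (rho * Num.sqrt rho)) <= d1 + d2.
    have g1 : 0 <= Num.sqrt y / (4 * (focal_dist (- r) y x * Num.sqrt (focal_dist (- r) y x))).
      by rewrite divr_ge0 ?mulr_ge0 ?sqrtr_ge0 ?(ltW A0).
    have g2 : 0 <= Num.sqrt y / (4 * (focal_dist r y x * Num.sqrt (focal_dist r y x))).
      by rewrite divr_ge0 ?mulr_ge0 ?sqrtr_ge0 ?(ltW B0).
    by rewrite /rho; case: (leP (focal_dist (- r) y x) (focal_dist r y x)) => _; lra.
  have rho0 : 0 < rho by rewrite lt_min A0.
  have yf a : y <= focal_dist a y x.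
    have := focal_dist_sqr a y x; have := focal_dist_ge0 a y x; have := sqr_ge0 (x - a).
    by move=> *; rewrite -(@ler_pXn2r _ 2%N) ?nnegrE ?(ltW y0)//; lra.
  have yrho : y <= rho by rewrite le_min !yf.
  (* The foci are [2 r] apart, so the farther one is at distance at least [r]. *)
  have Wrho : r * rho <= p ^+ 2 + q ^+ 2.
    rewrite EW.
    have := focal_dist_ge (- r) y x; have := focal_dist_ge r y x.
    rewrite !ler_norml => /andP[h1 h2] /andP[h3 h4].
    by rewrite /rho; case: (leP (focal_dist (- r) y x) (focal_dist r y x)) => ?; nra.
  have Epert := @inv_sqrt_perturbation _ x y p q U V
     (U ^+ 2 - V ^+ 2 - (x ^+ 2 - y ^+ 2 - 2)) (2 * (U * V) - 2 * (x * y)) rho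
     y0 q0 _ yrho Epq Epq' Wrho _ _ _.
  have {}Epert : `|V / (U ^+ 2 + V ^+ 2) - q / (p ^+ 2 + q ^+ 2)| <=
      5 / 4 * y / (rho * Num.sqrt rho).
    apply: Epert; [by rewrite divr_gt0|by ring|by ring|].
    have s2 : 0 < s ^+ 2 by rewrite exprn_gt0.
    have scale a b w : `|a - s ^+ 2 * b| <= s ^+ 2 * w -> `|a / s ^+ 2 - b| <= w.
      move=> h; have -> : a / s ^+ 2 - b = (a - s ^+ 2 * b) / s ^+ 2 by field.
      by rewrite normrM normfV (gtr0_norm s2) ler_pdivrMr// [leRHS]mulrC.
    have := scale _ _ _ Ere; have := scale _ _ _ Eim.
    rewrite (_ : 2 * (u x * v x) / s ^+ 2 = 2 * (U * V)); last by rewrite /U /V; field.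
    rewrite (_ : (u x ^+ 2 - v x ^+ 2) / s ^+ 2 = U ^+ 2 - V ^+ 2); last by rewrite /U /V; field.
    rewrite !ler_norml => /andP[e1 e2] /andP[e3 e4]; nra.
  have -> : k * (d1 + d2) = 5 * Num.sqrt y * (d1 + d2) / pi by rewrite /k; ring.
  rewrite -mulrBl normrM normfV (gtr0_norm p0) ler_wpM2r ?invr_ge0 ?(ltW p0)//.
  apply: (le_trans Epert).
  have ry : 0 <= 5 * Num.sqrt y by rewrite mulr_ge0 ?sqrtr_ge0.
  apply: le_trans (ler_wpM2l ry rl).
  have ey : Num.sqrt y ^+ 2 = y by rewrite sqr_sqrtr// ltW.
  rewrite -[X in 5 / 4 * X / _]ey le_eqVlt; apply/orP; left; apply/eqP.
  have := rho0; rewrite -sqrtr_gt0; move: (Num.sqrt rho) (Num.sqrt y) => g Y g0.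
  by field; rewrite !gt_eqF.
(* The two signs encode [|H'| <= k (Phi (- r) + Phi r)'] as two monotonicity statements. *)
have incr (sg : R) : sg = 1 \/ sg = -1 ->
    {homo (fun x => k * (Phi (- r) x + Phi r x) + sg * H x) : x z / x <= z}.
  move=> sgE.
  have [h Hh] := choice dH; have {Hh}[e He] := choice Hh.
  apply: (@is_derive_ge0_homo _ _ (fun x => k * e x + sg * h x)) => x.
    have [D1 D2 _] := He x.
    exact: (is_deriveD (is_deriveZ k D2) (is_deriveZ sg D1)).
  have [_ _] := He x; rewrite ler_norml => /andP[h1 h2].
  by case: sgE => ->; lra.
move=> x; rewrite -/(H x).
have Y1 : 0 < Num.sqrt y by rewrite sqrtr_gt0.
have [X0 small] := smoothed_cdf_small m Y0 Y1.
(* At this point the arcsine distribution function vanishes and the smoothed one is at most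
   [sqrt y]. *)
pose x0 := Num.min x (Num.min (- r) (X0 / s)).
have [xx0 [xr xX]] : x0 <= x /\ x0 <= - r /\ x0 <= X0 / s.
  by rewrite /x0 !ge_min !lexx ?orbT.
have sx0 : smoothed_cdf m (s * y) (s * x0) <= Num.sqrt y.
  by apply: small; rewrite mulrC -ler_pdivlMr.
have sx1 := smoothed_cdf_ge0 m (s * x0) Y0.
have := arcsine_cdf_holdery x0 (ltW y0); rewrite arcsine_cdf0_le// subr0.
have /andP[a0 _] := arcsine_cdf_bounds y x0; rewrite ger0_norm// => a1.
have Pb : k * (Phi (- r) x + Phi r x) - k * (Phi (- r) x0 + Phi r x0) <= 5 * Num.sqrt y.
  have -> : 5 * Num.sqrt y = k * pi by rewrite /k divfK// gt_eqF.
  rewrite -mulrBr ler_wpM2l//.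
  have := Phib (- r) x; have := Phib r x; have := Phib (- r) x0; have := Phib r x0.
  by move=> /andP[? ?] /andP[? ?] /andP[? ?] /andP[? ?]; lra.
have := incr 1 (or_introl erefl) _ _ xx0; have := incr (-1) (or_intror erefl) _ _ xx0.
rewrite !mul1r !mulN1r => i1 i2.
have Hx0 : - (3 / 2 * Num.sqrt y) <= H x0 <= Num.sqrt y.
  by rewrite /H; apply/andP; split; lra.
move: Hx0 => /andP[? ?]; rewrite ler_norml; apply/andP; split; lra.
Qed.

(** * Dilation and the choice of parameters *)

Lemma dilation_itv (R : realType) (s x : R) (m : {measure set (measurableTypeR R) -> \bar R}) :
  0 < s -> dilation s m `]-oo, x]%classic = m `]-oo, (s * x)%R]%classic.
Proof.
move=> s0; rewrite /dilation; congr (m _); apply/seteqP; split => t /=.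
  by move=> [z]; rewrite !in_itv/= => zx <-; rewrite ler_pM2l.
rewrite !in_itv/= => tx; exists (t / s); last by rewrite mulrC divfK// gt_eqF.
by rewrite in_itv/= ler_pdivrMr// mulrC.
Qed.

Theorem theorem1p1 (R : realType)
    (mu : probability (measurableTypeR R) R)
    (nu : {finite_measure set (measurableTypeR R) -> \bar R}) (c : R)
    (mean0 : expectation mu (fun t : R => t) = 0%E)
    (var1 : variance mu (fun t : R => t) = 1%E)
    (repr : nevanlinna_measure mu nu)
    (moment : (\int[nu]_t (`|t|)%:E)%E = c%:E)
    (c_gt0 : 0 < c) :
  exists N : nat, forall n : nat, (1 <= n)%N -> (N <= n)%N ->
    forall mun : probability (measurableTypeR R) R,
      is_monotone_power mu n mun ->
      (ereal_sup [set `|dilation (Num.sqrt n%:R) mun `]-oo, x]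
                        - arcsine `]-oo, x] | | x in [set: R]]
       <= (71 * c `^ (1 / 4) * n%:R `^ (- (1 / 8)))%:E)%E.
Proof.
(* [n >= c ^ (- 6)] amounts to [s c ^ 3 >= 1], hence to [1 / (s c) <= b ^ 2]: the contribution of
   the squared Stieltjes transform is then no larger in order than that of the moment. *)
exists (Num.truncn (c^-1 ^+ 6)).+1 => n n1 nN mun Hmun.
have n0 : 0 < n%:R :> R by rewrite ltr0n.
pose s : R := Num.sqrt n%:R; rewrite -/s.
have s0 : 0 < s by rewrite sqrtr_gt0.
have es : s ^+ 2 = n%:R by rewrite sqr_sqrtr// ltW.
pose b : R := c `^ (1 / 4) * n%:R `^ (- (1 / 8)).
have -> : 71 * c `^ (1 / 4) * n%:R `^ (- (1 / 8)) = 71 * b by rewrite /b mulrA.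
have b0 : 0 < b by rewrite mulr_gt0// powR_gt0.
have eb : b ^+ 4 * s = c.
  rewrite /b exprMn -!powR_mulrn ?powR_ge0// -!powRrM.
  have -> : 1 / 4 * 4%:R = 1 :> R by field.
  rewrite powRr1 ?ltW// /s -powR12_sqrt ?(ltW n0)// -mulrA -powRD.
    have -> : - (1 / 8) * 4%:R + 2^-1 = 0 :> R by field.
    by rewrite powRr0 mulr1.
  by rewrite (gt_eqF n0) implybT.
have s3 : c^-1 ^+ 3 <= s.
  rewrite -(@ler_pXn2r _ 2%N) ?nnegrE ?(ltW s0) ?exprn_ge0 ?invr_ge0 ?(ltW c_gt0)//.
  rewrite es -exprM; apply: (le_trans (ltW (truncnS_gt _))).
  by rewrite ler_nat.
have sc3 : 1 <= s * c ^+ 3.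
  have := ler_wpM2r (exprn_ge0 3 (ltW c_gt0)) s3.
  by rewrite -exprMn mulVf ?gt_eqF// expr1n.
have b2 : 0 < b ^+ 2 by rewrite exprn_gt0.
have sc0 : 0 < s * c := mulr_gt0 s0 c_gt0.
have scb : 1 <= s * c * b ^+ 2.
  have h : 0 < s * c * b ^+ 2 := mulr_gt0 sc0 b2.
  rewrite -(@ler_pXn2r _ 2%N) ?nnegrE ?(ltW h)// expr1n.
  have -> : (s * c * b ^+ 2) ^+ 2 = s * c ^+ 2 * (b ^+ 4 * s) by ring.
  by rewrite eb; apply: (le_trans sc3); rewrite le_eqVlt; apply/orP; left; apply/eqP; ring.
pose y := 4 * b ^+ 2.
have y0 : 0 < y by rewrite mulr_gt0.
have sy : Num.sqrt y = 2 * b.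
  rewrite /y (_ : 4 * b ^+ 2 = (2 * b) ^+ 2); last by ring.
  by rewrite sqrtr_sqr ger0_norm// mulr_ge0// ltW.
have Y0 : 0 < s * y by rewrite mulr_gt0.
(* Since [b ^ 4 s = c] and [y = 4 b ^ 2], the bracket is at most [b ^ 2 / 2 + b ^ 2 / 16]. *)
have Ebound : n%:R * (2 * (c / (s * y)) + (s * y)^-1 ^+ 2) <= s ^+ 2 * (7 / 10 * y).
  rewrite -es ler_wpM2l ?sqr_ge0//.
  have -> : c / (s * y) = b ^+ 2 / 4 by rewrite -eb /y; field; rewrite !gt_eqF.
  have -> : (s * y)^-1 ^+ 2 = (s * c)^-1 / 16 by rewrite -eb /y; field; rewrite !gt_eqF.
  have : (s * c)^-1 <= b ^+ 2 by rewrite -[leLHS]mul1r ler_pdivrMr// [leRHS]mulrC.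
  by rewrite /y; set z := (s * c)^-1; lra.
have close x : `|smoothed_cdf mun (s * y) (s * x) - arcsine_cdf y x| <= 15 / 2 * Num.sqrt y.
  apply: smoothed_cdf_arcsine => // {}x.
  rewrite Hmun//.
  have [h1 h2 h3] := iter_F_transform_sqr (s * x) n Y0 repr moment.
  split; first exact: lt_le_trans h1.
    rewrite (_ : s ^+ 2 * _ = (s * x) ^+ 2 - (s * y) ^+ 2 - 2 * n%:R); last by rewrite -es; ring.
    exact: le_trans h2 Ebound.
  rewrite (_ : s ^+ 2 * (2 * _) = 2 * (s * x * (s * y))); last by ring.
  exact: le_trans h3 Ebound.
pose M x := cdf_at mun (s * x).
have [m m0 mb] : exists2 m : nat, (0 < m)%N & (2 * m%:R)^-1 <= b.
  exists (Num.truncn (b^-1)).+1 => //.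
  have h := ltW (truncnS_gt b^-1).
  have q0 : 0 < 2 * (Num.truncn (b^-1)).+1%:R :> R by rewrite mulr_gt0// ltr0n.
  rewrite invf_ple// (le_trans h)//.
  by rewrite ler_peMl// ler1n.
(* Here [sqrt y = 2 b] and [d = (15 / 2 + 3 / 2) sqrt y = 18 b]; the smoothing inequality gives
   [36 b + 9 b + b], within the stated constant. *)
have key x : `|M x - arcsine_cdf 0 x| <= 71 * b.
  have := @smoothing_inequality _ M (arcsine_cdf 0) (fun x => smoothed_cdf mun (s * y) (s * x))
    (3 / 2) (9 * Num.sqrt y) y m m0 y0 _ _ _ _ _ _ _ x.
  rewrite sy => h; apply: (le_trans (h _ _ _ _ _ _ _)); last by lra.
  - by lra.
  - by move=> u v uv; apply: cdf_at_mono; rewrite ler_pM2l.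
  - by move=> u; exact: cdf_at_bounds.
  - by move=> u; exact: arcsine_cdf_bounds.
  - by move=> u v; exact: arcsine_cdf_holder.
  - move=> u; rewrite /M; under eq_bigr do rewrite mulrDr mulrA.
    have m4 : (0 < 4 * m)%N by rewrite muln_gt0.
    exact: (smoothed_cdf_levels mun (s * u) m4 Y0).
  move=> u; have := close u; have := arcsine_cdf_holdery u (ltW y0).
  rewrite sy !ler_norml => /andP[? ?] /andP[? ?]; apply/andP; split; lra.
apply: ge_ereal_sup => _ [x _ <-].
have E : dilation s mun `]-oo, x]%classic = (M x)%:E.
  rewrite dilation_itv//; apply/esym; apply: fineK.
  by apply: fin_num_measure; exact: measurable_itv.
by rewrite E arcsine_cdfE lee_fin; exact: key.
Qed.
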